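(* Let $m\ge 1$ and $N\ge 1$ be integers, let $h=1/N$, and let $q_1,\dots,q_{m-1}$ be the roots with $|q_k|<1$ of the Euler–Frobenius polynomial $E_{2m-2}(x)$ of degree $2m-2$. Let $C[\beta]$, $\beta=0,1,\dots,N$, be the optimal coefficients (in the sense of Sard) of quadrature formulas of the form $$\int_0^1\varphi(x)\,dx\cong\sum_{\beta=0}^N C[\beta]\,\varphi(h\beta)$$ on the space $L_2^{(m)}(0,1)$, extended by $C[\beta]=0$ for integers $\beta<0$ and $\beta>N$. Then these optimal coefficients have the form $$ C[\beta]=h\left\{ \begin{array}{ll} \displaystyle \frac12-\sum_{k=1}^{m-1}d_k\,\frac{q_k-q_k^N}{1-q_k} & \text{for }\beta=0,N,\\[2mm] \displaystyle 1+\sum_{k=1}^{m-1}d_k\left(q_k^{\beta}+q_k^{N-\beta}\right) & \text{for }\beta=1,2,\dots,N-1,\\[2mm] 0 & \text{for }\beta<0,\ \beta>N, \end{array}\right. $$ where $d_1,\dots,d_{m-1}$ are real numbers satisfying the system of linear equations $$ \sum_{k=1}^{m-1}d_k\sum_{i=1}^{j}\frac{q_k+(-1)^{i+1}q_k^{N+i}}{(q_k-1)^{i+1}}\,\Delta^i0^j=\frac{B_{j+1}}{j+1},\qquad j=1,2,\dots,m-1 . $$ (For $m=1$ the sums over $k$ and the system are empty.)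
   Context: Space: $L_2^{(m)}(0,1)$ is the Sobolev space of real functions $\varphi$ on $[0,1]$ whose $m$-th (generalized) derivative is square integrable, with (semi)norm $\|\varphi|L_2^{(m)}(0,1)\|=\left(\int_0^1(\varphi^{(m)}(x))^2dx\right)^{1/2}$. Error functional: for coefficients $C[0],\dots,C[N]$ put $(\ell,\varphi)=\int_0^1\varphi(x)\,dx-\sum_{\beta=0}^N C[\beta]\varphi(h\beta)$. It is regarded as an element of the conjugate space $L_2^{(m)*}(0,1)$, i.e. as a functional with finite norm $\|\ell\|=\sup_{\|\varphi\|\ne 0}|(\ell,\varphi)|/\|\varphi|L_2^{(m)}(0,1)\|$; in particular it vanishes on polynomials of degree $\le m-1$, i.e. $\sum_{\gamma=0}^N C[\gamma](h\gamma)^\alpha=\frac1{\alpha+1}$ for $\alpha=0,\dots,m-1$. Optimal coefficients (in the sense of Sard): the coefficients $C[\beta]$ (if they exist) for which the norm $\|\ell\|$ attains its infimum over all choices of coefficients with the nodes $h\beta$ fixed, that is, which realize $\inf_{C[\beta]}\sup_{\|\varphi\|\neq0}|(\ell,\varphi)|/\|\varphi|L_2^{(m)}(0,1)\|$. It is known (Sobolev) that they are characterized by the following linear system in the unknowns $C[0],\dots,C[N],\lambda_0,\dots,\lambda_{m-1}$, whose solution is assumed to exist and be unique: $$\sum_{\gamma=0}^N C[\gamma]\frac{|h\beta-h\gamma|^{2m-1}}{2(2m-1)!}+\sum_{\alpha=0}^{m-1}\lambda_\alpha (h\beta)^\alpha=\frac{(h\beta)^{2m}+(1-h\beta)^{2m}}{2(2m)!},\quad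 \beta=0,1,\dots,N,$$ $$\sum_{\gamma=0}^N C[\gamma](h\gamma)^\alpha=\frac{1}{\alpha+1},\quad \alpha=0,\dots,m-1.$$ Euler–Frobenius polynomials: $E_k(x)$ ($k\ge0$) is the polynomial of degree $k$ defined by $xE_k(x)=(1-x)^{k+2}D^k\frac{x}{(1-x)^2}$, where $D=x\frac{d}{dx}$ and $D^k$ is its $k$-th iterate. Its roots are known to be real, negative and distinct, $q^{(k)}_1<\dots<q^{(k)}_k<0$, with $q^{(k)}_j q^{(k)}_{k+1-j}=1$; hence $E_{2m-2}$ has exactly $m-1$ roots with $|q|<1$. $\Delta^i0^j$ is the $i$-th order forward finite difference (step $1$) of $\gamma\mapsto\gamma^j$ at $\gamma=0$: $\Delta^i0^j=\sum_{\alpha=0}^i(-1)^{i-\alpha}\binom{i}{\alpha}\alpha^j$. $B_n$ are the Bernoulli numbers ($B_2=\tfrac16$, $B_3=0$, $B_4=-\tfrac1{30}$, ...). *)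

(* Defs.v *)
From HB Require Import structures.
From mathcomp Require Export all_boot all_order all_algebra.
From mathcomp Require Export all_classical all_reals all_analysis.

Set Implicit Arguments.
Unset Strict Implicit.
Unset Printing Implicit Defensive.
Import Order.TTheory GRing.Theory Num.Theory.
Import numFieldNormedType.Exports.

Local Open Scope classical_set_scope.
Local Open Scope ring_scope.

(* Functions on [0, 1] are represented by total functions R -> R whose values
   outside [0, 1] are never used.  Coefficients C[b] are indexed by all
   integers b, as the extension by zero is part of the theory. *)

(* u is absolutely continuous on [0, 1] with a.e. derivative v. *)
Definition indefinite_integral (R : realType) (u v : R -> R) : Prop :=
  (@lebesgue_measure R).-integrable `[0, 1] (EFin \o v) /\
  forall x : R, 0 <= x <= 1 ->
    u x = u 0 + \int[@lebesgue_measure R]_(t in `[0, x]) v t.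

(* g is an m-th generalized derivative of phi on (0, 1), where phi is taken to
   be its continuous representative (m >= 1): phi, ..., phi^(m-1) are
   absolutely continuous and phi^(m) = g almost everywhere. *)
Definition gen_derivative (R : realType) (m : nat) (phi g : R -> R) : Prop :=
  exists D : nat -> R -> R,
    [/\ D 0%N = phi, D m = g
      & forall k, (k < m)%N -> indefinite_integral (D k) (D k.+1)].

Definition square_integrable (R : realType) (g : R -> R) : Prop :=
  measurable_fun (`[0, 1] : set R) g /\
  (@lebesgue_measure R).-integrable `[0, 1] (EFin \o (fun x => g x ^+ 2)).

Definition L2norm (R : realType) (g : R -> R) : R :=
  Num.sqrt (\int[@lebesgue_measure R]_(x in `[0, 1]) (g x ^+ 2)).

(* phi belongs to L_2^(m)(0,1) and r is its seminorm.  The value r is unique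
   because two m-th generalized derivatives of phi agree almost everywhere. *)
Definition sobolev_seminorm (R : realType) (m : nat) (phi : R -> R) (r : R)
  : Prop :=
  exists g : R -> R,
    [/\ gen_derivative m phi g, square_integrable g & r = L2norm g].

Definition node (R : realType) (N b : nat) : R := N%:R^-1 * b%:R.

Definition error_functional (R : realType) (N : nat) (C : int -> R)
    (phi : R -> R) : R :=
  \int[@lebesgue_measure R]_(x in `[0, 1]) phi x
  - \sum_(b < N.+1) C b%:Z * phi (node R N b).

Definition error_norm (R : realType) (m N : nat) (C : int -> R) : \bar R :=
  ereal_sup [set z : \bar R | exists (phi : R -> R) (r : R),
    [/\ sobolev_seminorm m phi r, r != 0
      & z = (`|error_functional N C phi| / r)%:E]].

(* Finiteness of the norm says that the error functional belongs to the
   conjugate space; in particular it vanishes on polynomials of degree < m. *)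
Definition sard_optimal (R : realType) (m N : nat) (C : int -> R) : Prop :=
  (error_norm m N C < +oo)%E /\
  forall C' : int -> R, (error_norm m N C <= error_norm m N C')%E.

(* The stationarity conditions of the squared norm of the error functional,
   lam being the Lagrange multipliers of exactness in degree < m. *)
Definition sobolev_system (R : realType) (m N : nat)
    (C : 'rV[R]_N.+1) (lam : 'rV[R]_m) : Prop :=
  (forall b : 'I_N.+1,
     \sum_(c < N.+1) C 0 c * (`|node R N b - node R N c| ^+ (2 * m - 1)
                              / (2 * ((2 * m - 1)`!)%:R))
     + \sum_(a < m) lam 0 a * node R N b ^+ a
     = (node R N b ^+ (2 * m) + (1 - node R N b) ^+ (2 * m))
       / (2 * ((2 * m)`!)%:R)) /\
  (forall a : 'I_m,
     \sum_(c < N.+1) C 0 c * node R N c ^+ a = (a.+1)%:R^-1).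

Definition sobolev_system_uniquely_solvable (R : realType) (m N : nat)
  : Prop :=
  exists! x : 'rV[R]_N.+1 * 'rV[R]_m, sobolev_system x.1 x.2.

Definition euler_op (R : realType) (f : R -> R) : R -> R :=
  fun x => x * derive1 f x.

(* The rational function is handled as a function on R, its only pole being 1. *)
Definition euler_frobenius (R : realType) (k : nat) (E : {poly R}) : Prop :=
  size E = k.+1 /\
  forall x : R, x != 1 ->
    x * E.[x] = (1 - x) ^+ (k + 2)
                * iter k (@euler_op R) (fun y => y / (1 - y) ^+ 2) x.

(* q enumerates, without repetition, the roots of E in the open unit disc. *)
Definition inner_roots (R : realType) (n : nat) (E : {poly R})
    (q : 'I_n -> R) : Prop :=
  injective q /\
  forall x : R, (root E x /\ `|x| < 1) <-> (exists k, q k = x).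

(* The sequence B_0, ..., B_n, by
   B_n = - 1/(n+1) * sum_(k < n) binom(n+1, k) B_k  and  B_0 = 1. *)
Fixpoint bernoulli_seq (R : realType) (n : nat) : seq R :=
  if n is n'.+1 then
    let s := bernoulli_seq R n' in
    rcons s (- (\sum_(k < n) 'C(n.+1, k)%:R * s`_k) / n.+1%:R)
  else [:: 1].

Definition bernoulli (R : realType) (n : nat) : R := (bernoulli_seq R n)`_n.

(* The i-th forward difference of a |-> a ^ j at 0. *)
Definition diff0 (R : realType) (i j : nat) : R :=
  \sum_(a < i.+1) (-1) ^+ (i - a) * 'C(i, a)%:R * a%:R ^+ j.

(* Main.v *)
(* Let psi be the spline with psi^(m) = (-1)^m K, where K is the Peano kernel of
   the rule solving Sobolev's system; by that system psi can be chosen to vanish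
   at the nodes.  Every rule then has the error \int psi = (-1)^m \int K^2 at
   psi, so by Cauchy-Schwarz the solution of the system is optimal, and comparing
   first variations along polynomials shows that it is the only optimal rule.

   To solve the system on the lattice h = 1, let [regsum z p] be the rational
   function \sum_{g >= 0} p(g) z^g and P = x^(2m-1) / (2m-1)!.  Stationarity at
   the nodes, exactness and the symmetry of the rule give
     (\sum_g C_g z^g) regsum z P = regsum z u + z^N regsum z^-1 u
   for a polynomial u = x^(2m) / (2m)! + (terms of degree < m) with u(0) = 0.
   Since regsum z P = z E(z) / ((1 - z)^(2m) (2m-1)!), it vanishes at the roots r
   of E = E_(2m-2), and the 2m polynomials P, Y with Y(x+1) - Y(x) = P(x), and y_r
   with y_r(x) - r y_r(x+1) = P(x) form a basis of the polynomials of degree <= 2m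
   vanishing at 0; on them regsum z is regsum z P times 1, z / (1 - z) and
   z / (z - r).  Expanding u in this basis yields \sum_g C_g z^g in partial
   fractions.  As it is a polynomial in z, its residues vanish, which leaves the
   geometric sums in q_k and 1 / q_k; the vanishing of the coefficients of u in
   the degrees m, ..., 2m-1 gives the value of C_0 and the equations for d. *)
From HB Require Import structures.
From mathcomp Require Import ring lra zify.
From mathcomp Require Import measurable_realfun.
Require Import Defs.

Set Implicit Arguments.
Unset Strict Implicit.
Unset Printing Implicit Defensive.
Import Order.TTheory GRing.Theory Num.Theory.
Import numFieldNormedType.Exports.

Local Open Scope classical_set_scope.
Local Open Scope ring_scope.

(** * Regularized power sums *)

Definition fdiff (R : realType) (p : {poly R}) : {poly R} :=
  p \Po ('X + 1) - p.

Lemma fdiffP (R : realType) : linear (@fdiff R).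
Proof.
by move=> a p q; rewrite /fdiff linearP /= scalerBr opprD addrACA.
Qed.

HB.instance Definition _ (R : realType) :=
  GRing.isLinear.Build R {poly R} {poly R} _ (@fdiff R) (@fdiffP R).

Lemma size_XaddC1 (R : realType) : size ('X + 1 : {poly R}) = 2%N.
Proof. by rewrite -(opprK 1) -polyCN size_XsubC. Qed.

Lemma lead_coef_shift (R : realType) (p : {poly R}) :
  lead_coef (p \Po ('X + 1)) = lead_coef p.
Proof.
rewrite lead_coef_comp ?size_XaddC1 //.
by rewrite -(opprK 1) -polyCN lead_coefXsubC expr1n mulr1.
Qed.

Lemma size_shift (R : realType) (p : {poly R}) :
  size (p \Po ('X + 1)) = size p.
Proof. by rewrite size_comp_poly2 ?size_XaddC1. Qed.

Lemma size_fdiff (R : realType) (p : {poly R}) :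
  (size (fdiff p) <= (size p).-1)%N.
Proof.
apply/leq_sizeP => j; rewrite leq_eqVlt => /orP[/eqP <-|hj].
  rewrite /fdiff coefB -{1}size_shift.
  by rewrite -!lead_coefE lead_coef_shift subrr.
have hs : (size p <= j)%N by lia.
by rewrite coefB !nth_default ?subrr // size_shift.
Qed.

Lemma iter_fdiff0 (R : realType) (i : nat) (p : {poly R}) :
  (size p <= i)%N -> iter i (@fdiff R) p = 0.
Proof.
elim: i p => [|i IH] p; first by rewrite leqn0 size_poly_eq0 => /eqP.
by move=> hp; rewrite iterSr IH // (leq_trans (size_fdiff p)) // -subn1 leq_subLR.
Qed.

Lemma iter_fdiffP (R : realType) (i : nat) : linear (iter i (@fdiff R)).
Proof.
by elim: i => [|i IH] a p q //=; rewrite IH linearP.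
Qed.

(* The value at z of the power series [\sum_(g >= 0) p(g) z^g], continued
   analytically to all z != 1. *)
Definition regsum (R : realType) (z : R) (p : {poly R}) : R :=
  \sum_(i < size p) (iter i (@fdiff R) p).[0] * (z ^+ i / (1 - z) ^+ i.+1).

Lemma regsumE (R : realType) (z : R) (p : {poly R}) (D : nat) :
  (size p <= D)%N ->
  regsum z p = \sum_(i < D) (iter i (@fdiff R) p).[0] * (z ^+ i / (1 - z) ^+ i.+1).
Proof.
move=> hD; rewrite /regsum (big_ord_widen _ (fun i : nat =>
  (iter i (@fdiff R) p).[0] * (z ^+ i / (1 - z) ^+ i.+1)) hD) [RHS]big_mkcond /=.
rewrite big_mkcond; apply: eq_bigr => i _; case: ltnP => // hi.
by rewrite iter_fdiff0 // horner0 mul0r.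
Qed.

Lemma regsumP (R : realType) (z : R) : scalar (regsum z).
Proof.
move=> a p q; set D := maxn (size p) (size q).
have hp : (size p <= D)%N by rewrite leq_maxl.
have hq : (size q <= D)%N by rewrite leq_maxr.
have hpq : (size (a *: p + q : {poly R})%R <= D)%N.
  rewrite (leq_trans (size_polyD _ _)) // geq_max hq andbT.
  exact: leq_trans (size_scale_leq _ _) hp.
rewrite (regsumE _ hp) (regsumE _ hq) (regsumE _ hpq) mulr_sumr -big_split /=.
apply: eq_bigr => i _.
by rewrite iter_fdiffP hornerD hornerZ mulrDl mulrA.
Qed.

HB.instance Definition _ (R : realType) (z : R) :=
  GRing.isLinear.Build R {poly R} R _ (regsum z) (@regsumP R z).

Lemma regsumZ (R : realType) (z a : R) (p : {poly R}) :
  regsum z (a *: p) = a * regsum z p.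
Proof. exact: linearZ. Qed.

(** Splitting off the term g = 0 survives the continuation. Peeling i = 0 off the defining sum gives
    (1 - z) S(p) = p(0) + z S(fdiff p), and p(x + 1) is p + fdiff p. *)
Lemma regsum_shift (R : realType) (z : R) (p : {poly R}) : z != 1 ->
  regsum z p = p.[0] + z * regsum z (p \Po ('X + 1)).
Proof.
move=> z1; have z10 : 1 - z != 0 by rewrite subr_eq0 eq_sym.
have -> : p \Po ('X + 1) = p + fdiff p by rewrite /fdiff [RHS]addrC subrK.
rewrite linearD /=.
suff E : (1 - z) * regsum z p = p.[0] + z * regsum z (fdiff p).
  by rewrite mulrDr addrA addrAC -E; ring.
rewrite (@regsumE _ _ p (size p).+1) // big_ord_recl /= mulrDr.
rewrite expr0 expr1 mulrCA div1r mulfV // mulr1; congr (_ + _).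
rewrite (@regsumE _ _ (fdiff p) (size p)); last first.
  by rewrite (leq_trans (size_fdiff p)) ?leq_pred.
rewrite !mulr_sumr; apply: eq_bigr => i _.
rewrite -iterS iterSr /bump /= add1n.
rewrite (exprS (1 - z) i.+1) invfM (exprS z i).
by move: (1 - z) z10 => w w0; rewrite -[RHS]mul1r -(mulfV w0); ring.
Qed.

(** Uniqueness principle that proves identities between regularized sums from their functional
    equations. By induction on the degree F vanishes on [fdiff p], so the equation reads F p = z F
    p. *)
Lemma regsum_unique (R : realType) (z : R) (F : {linear {poly R} -> R | *%R}) :
  z != 1 -> (forall p, F p = z * F (p \Po ('X + 1))) -> forall p, F p = 0.
Proof.
move=> z1 hF p; have [n] := ubnP (size p).
elim: n p => // n IH p; rewrite ltnS => hp.
have [->|p0] := eqVneq p 0; first by rewrite linear0.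
have hd : F (fdiff p) = 0.
  apply: IH; rewrite (leq_ltn_trans (size_fdiff p)) //.
  by rewrite -size_poly_gt0 in p0; lia.
have := hF p; have -> : p \Po ('X + 1) = p + fdiff p by rewrite /fdiff [RHS]addrC subrK.
rewrite linearD hd addr0 => /eqP; rewrite -subr_eq0 -{1}[F p]mul1r -mulrBl mulf_eq0.
by rewrite subr_eq0 eq_sym (negPf z1) /= => /eqP.
Qed.

Lemma regsum_sum (R : realType) (z : R) (p : {poly R}) (K : nat) : z != 1 ->
  \sum_(b < K) p.[b%:R] * z ^+ b
  = regsum z p - z ^+ K * regsum z (p \Po ('X + K%:R%:P)).
Proof.
move=> z1; elim: K => [|K IH].
  by rewrite big_ord0 expr0 mul1r addr0 comp_polyXr subrr.
rewrite big_ord_recr /= IH (@regsum_shift _ _ (p \Po ('X + _)) z1).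
rewrite horner_comp !hornerE -comp_polyA comp_polyD comp_polyX comp_polyC.
rewrite (_ : 'X + 1 + K%:R%:P = 'X + K.+1%:R%:P :> {poly R}); last first.
  by rewrite -addrA -(natr1 K) polyCD [1 + _]addrC.
by rewrite exprS; ring.
Qed.

(** The sum of p(g) z^-g over all integers g regularizes to 0: it is the functional [F] below, and
    shift invariance of the two-sided sum is exactly the hypothesis of [regsum_unique]. *)
Lemma regsum_reflect (R : realType) (z : R) (p : {poly R}) :
  z != 0 -> z != 1 ->
  regsum z (p \Po (- 'X - 1)) = - z^-1 * regsum z^-1 p.
Proof.
move=> z0 z1; have zV1 : z^-1 != 1 by rewrite invr_eq1.
pose F p := z * regsum z (p \Po (- 'X - 1)) + regsum z^-1 p.
have FP : scalar F.
  by move=> a u v; rewrite /F comp_polyD comp_polyZ !linearP /=; ring.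
pose FL := GRing.isLinear.Build R {poly R} R _ F FP.
pose G : {linear {poly R} -> R | *%R} := HB.pack F FL.
suff : F p = 0.
  by rewrite /F => /eqP; rewrite addr_eq0 => /eqP h; rewrite mulNr -mulrN -h mulKf.
apply: (@regsum_unique _ _ G zV1) => {}p; change (F p = z^-1 * F (p \Po ('X + 1))).
have h1 : (p \Po ('X + 1)) \Po (- 'X - 1) = p \Po - 'X.
  by rewrite -comp_polyA comp_polyD comp_polyX -polyC1 comp_polyC polyC1 subrK.
have h2 : (p \Po - 'X) \Po ('X + 1) = p \Po (- 'X - 1).
  by rewrite -comp_polyA linearN /= comp_polyX opprD.
have := regsum_shift (p \Po - 'X) z1; rewrite h2 horner_comp hornerN hornerX oppr0 => h3.
by rewrite /F (regsum_shift p zV1) h1 h3; field.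
Qed.

Lemma regsum_opp (R : realType) (z : R) (p : {poly R}) :
  z != 0 -> z != 1 ->
  regsum z (p \Po - 'X) = p.[0] - regsum z^-1 p.
Proof.
move=> z0 z1; rewrite (@regsum_shift _ _ (p \Po - 'X) z1) -comp_polyA.
have -> : - 'X \Po ('X + 1) = - 'X - 1 :> {poly R}.
  by rewrite linearN /= comp_polyX opprD.
by rewrite regsum_reflect // horner_comp hornerN hornerX oppr0; field.
Qed.

(** Oddness of x^n turns reflection into invariance under inversion; this is the reciprocity of the
    Euler-Frobenius roots. *)
Lemma regsumXn_inv (R : realType) (z : R) (n : nat) :
  odd n -> z != 0 -> z != 1 -> regsum z^-1 'X^n = regsum z 'X^n.
Proof.
move=> on z0 z1; have := @regsum_opp _ z 'X^n z0 z1.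
rewrite comp_Xn_poly exprNn -signr_odd on expr1 mulN1r linearN /= hornerXn expr0n.
by case: n on => // n _ /=; rewrite sub0r => /oppr_inj.
Qed.

(** Linear factors for the exceptional points make the product vanish everywhere, hence at more
    integers than a nonzero polynomial allows. *)
Lemma poly0_cofinite (R : realType) (p : {poly R}) (s : seq R) :
  (forall z, z \notin s -> p.[z] = 0) -> p = 0.
Proof.
move=> hp; apply/eqP; apply: contraT => p0.
pose q := p * \prod_(a <- s) ('X - a%:P).
have q0 : q != 0 by rewrite mulf_neq0 // monic_neq0 // monic_prod_XsubC.
have hq z : root q z.
  rewrite /q rootM root_prod_XsubC; case: (boolP (z \in s)) => hz.
    by rewrite orbT.
  by rewrite orbF; apply/rootP/hp.
pose rs := [seq i%:R : R | i <- iota 0 (size q)].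
have := @max_poly_roots _ q rs q0.
rewrite size_map size_iota ltnn => -> //; first by apply/allP => z _.
by rewrite map_inj_uniq ?iota_uniq // => i j /eqP; rewrite eqr_nat => /eqP.
Qed.

Lemma poly_ext (R : realType) (p q : {poly R}) :
  (forall z, p.[z] = q.[z]) -> p = q.
Proof.
move=> h; apply/eqP; rewrite -subr_eq0; apply/eqP.
by apply: (@poly0_cofinite _ _ [::]) => z _; rewrite hornerD hornerN h subrr.
Qed.

Lemma iter_fdiff_horner (R : realType) (i : nat) (p : {poly R}) (x : R) :
  (iter i (@fdiff R) p).[x]
  = \sum_(a < i.+1) (-1) ^+ (i - a) * 'C(i, a)%:R * p.[x + a%:R].
Proof.
elim: i x => [|i IH] x; first by rewrite big_ord1 /= addr0 bin0 expr0 !mul1r.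
rewrite /= /fdiff hornerD hornerN horner_comp hornerD hornerX hornerC !IH.
rewrite [in RHS]big_ord_recl /= bin0 subn0 addr0.
under [in RHS]eq_bigr => a _ do
  rewrite /bump /= add1n binS natrD mulrDr mulrDl subSS.
rewrite big_split /= addrA [RHS]addrC; congr (_ + _).
  by apply: eq_bigr => a _; rewrite -addrA nat1r.
rewrite [in RHS]big_ord_recr /= subnn bin_small // mulr0 mul0r addr0.
rewrite [in LHS]big_ord_recl /= subn0 bin0 addr0 opprD exprS mulN1r !mulNr.
congr (_ + _); rewrite -sumrN; apply: eq_bigr => a _.
by rewrite /bump /= add1n -!mulNr -mulN1r -exprS subnSK.
Qed.

(* The value at x is the regularized sum [\sum_g r ^ g (x + g) ^ n / n!]. *)
Definition regpoly (R : realType) (n : nat) (r : R) : {poly R} :=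
  \sum_(k < n.+1) (regsum r 'X^k / (k`! * (n - k)`!)%:R) *: 'X^(n - k).

Definition divpow (R : realType) (n : nat) : {poly R} := (n`!%:R)^-1 *: 'X^n.

Lemma fact_neq0 (R : realType) n : n`!%:R != 0 :> R.
Proof. by rewrite pnatr_eq0 -lt0n fact_gt0. Qed.

Lemma horner_divpow (R : realType) n (x : R) :
  (divpow R n).[x] = x ^+ n / n`!%:R.
Proof. by rewrite hornerZ hornerXn mulrC. Qed.

Lemma regpoly_horner (R : realType) (n : nat) (r x : R) :
  (regpoly n r).[x] = regsum r (divpow R n \Po ('X + x%:P)).
Proof.
rewrite comp_polyZ comp_Xn_poly linearZ /= addrC exprDn linear_sum /= mulr_sumr.
rewrite horner_sum; apply: eq_bigr => k _.
rewrite hornerZ hornerXn -polyC_exp mul_polyC raddfMn /= linearZ /=.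
have hk : (k <= n)%N by rewrite -ltnS.
have := fact_neq0 R n; have := fact_neq0 R k; have := fact_neq0 R (n - k).
rewrite -(bin_fact hk) !natrM => h1 h2 h3; rewrite -mulr_natr.
have h4 : 'C(n, k)%:R != 0 :> R by rewrite pnatr_eq0 -lt0n bin_gt0.
by field; rewrite h1 h2 h4.
Qed.

Lemma regpoly_shift (R : realType) (n : nat) (r : R) : r != 1 ->
  regpoly n r = divpow R n + r *: (regpoly n r \Po ('X + 1)).
Proof.
move=> r1; apply: poly_ext => x.
rewrite [RHS]hornerD (hornerZ r) horner_comp hornerD hornerX hornerC !regpoly_horner.
rewrite (regsum_shift _ r1) -comp_polyA comp_polyD comp_polyX comp_polyC.
rewrite horner_comp hornerD hornerX hornerC add0r.
by congr (_ + _ * regsum _ (_ \Po _)); rewrite polyCD addrAC addrA.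
Qed.

Lemma regpoly0 (R : realType) (n : nat) (r : R) :
  (regpoly n r).[0] = regsum r (divpow R n).
Proof. by rewrite regpoly_horner addr0 comp_polyXr. Qed.

(** Since r is a zero, y = [regpoly n r] vanishes at 0, so y(x) = P(x) + r y(x + 1) passes to
    [regsum z] without a boundary term. *)
Lemma regsum_regpoly (R : realType) (n : nat) (r z : R) :
  r != 1 -> z != 1 -> regsum r 'X^n = 0 ->
  (z - r) * regsum z (regpoly n r) = z * regsum z (divpow R n).
Proof.
move=> r1 z1 hr; have h0 : (regpoly n r).[0] = 0.
  by rewrite regpoly0 linearZ /= hr mulr0.
have h1 := regsum_shift (regpoly n r) z1; rewrite h0 add0r in h1.
have h2 : regsum z (regpoly n r)
    = regsum z (divpow R n) + r * regsum z (regpoly n r \Po ('X + 1)).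
  by rewrite {1}(regpoly_shift n r1) linearD [X in _ + X]linearZ.
by rewrite mulrBl {1}h2 h1; ring.
Qed.

(** * Bernoulli numbers and Faulhaber polynomials *)

Lemma size_bernoulli_seq (R : realType) n : size (bernoulli_seq R n) = n.+1.
Proof. by elim: n => //= n IH; rewrite size_rcons IH. Qed.

Lemma nth_bernoulli_seq (R : realType) n k : (k <= n)%N ->
  (bernoulli_seq R n)`_k = bernoulli R k.
Proof.
elim: n => [|n IH]; first by rewrite leqn0 => /eqP ->.
rewrite leq_eqVlt => /orP[/eqP -> //|hk].
by rewrite /= nth_rcons size_bernoulli_seq hk IH.
Qed.

Lemma sum_bernoulli (R : realType) n :
  \sum_(k < n.+1) 'C(n.+1, k)%:R * bernoulli R k = (n == 0%N)%:R.
Proof.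
case: n => [|n]; first by rewrite big_ord1 /= bin0 mul1r /bernoulli.
rewrite big_ord_recr /= {2}/bernoulli /= nth_rcons size_bernoulli_seq ltnn eqxx.
rewrite binSn mulrCA mulfV ?pnatr_eq0 // mulr1 
  -[RHS](subrr (\sum_(k < n.+1) 'C(n.+2, k)%:R * bernoulli R k)).
congr (_ - _); apply: eq_bigr => k _; rewrite nth_bernoulli_seq // -ltnS.
exact: ltn_ord.
Qed.

(* [faulhaber n] at N is [\sum_(g < N) g ^ n / n!]. *)
Definition faulhaber (R : realType) (n : nat) : {poly R} :=
  \sum_(k < n.+1) (bernoulli R k / (k`! * (n.+1 - k)`!)%:R) *: 'X^(n.+1 - k).

Lemma coef_revsum (R : realType) (c : nat -> R) (D D' j : nat) :
  (j < D <= D'.+1)%N ->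
  (\sum_(k < D) c k *: 'X^(D' - k))`_(D' - j) = c j.
Proof.
move=> /andP[hj hD]; rewrite coef_sum (bigD1 (Ordinal hj)) //=.
rewrite coefZ coefXn eqxx mulr1 big1 ?addr0 // => k; rewrite -val_eqE /= => hk.
rewrite coefZ coefXn; case: eqP => [|_]; last by rewrite mulr0.
by have := ltn_ord k; lia.
Qed.

Lemma coef_fdiffXn (R : realType) (j l : nat) :
  (fdiff ('X^j : {poly R}))`_l = if (l < j)%N then 'C(j, l)%:R else 0.
Proof.
rewrite /fdiff comp_Xn_poly coefB coefXn (addrC 'X) exprDn coef_sum.
rewrite (eq_bigr (fun i : 'I_j.+1 => if i == l :> nat then 'C(j, i)%:R else 0)); last first.
  move=> i _; rewrite expr1n mul1r coefMn coefXn eq_sym.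
  by case: eqP => _ //; rewrite mul0rn.
case: (ltngtP l j) => [hl|hl|->].
- rewrite subr0 (bigD1 (Ordinal (leqW hl : (l < j.+1)%N))) //= eqxx.
  rewrite big1 ?addr0 // => i; rewrite -val_eqE /=.
  by case: eqP.
- rewrite subr0 big1 // => i _; case: eqP => // hi.
  by have := ltn_ord i; lia.
rewrite (bigD1 ord_max) //= eqxx binn.
rewrite big1 ?addr0 ?subrr // => i; rewrite -val_eqE /=.
by case: eqP.
Qed.

(** In the coefficient of x^l the factorials recombine into binomials 'C(n - l + 1, k), which leaves
    the Bernoulli recursion at n - l. *)
Lemma fdiff_faulhaber (R : realType) (n : nat) :
  fdiff (faulhaber R n) = divpow R n.
Proof.
apply/polyP => l; rewrite /faulhaber linear_sum coef_sum coefZ coefXn.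
under eq_bigr => k _ do rewrite linearZ /= coefZ coef_fdiffXn.
have [hl|hl] := leqP l n; last first.
  rewrite gtn_eqF // mulr0 big1 // => k _.
  by case: ltnP => [|_]; [have := ltn_ord k; lia|rewrite mulr0].
have -> : (n = l + (n - l))%N by lia.
(* From here on [n] stands for the former n - l. *)
move: (n - l)%N => {hl}n.
have -> : (l == l + n)%N = (n == 0)%N by rewrite -{1}(addn0 l) eqn_add2l eq_sym.
have E := sum_bernoulli R n.
transitivity ((l`! * n.+1`!)%:R^-1 * (n == 0%N)%:R : R); last first.
  by case: n {E} => [|n] //=; rewrite ?mulr0 // muln1 addn0.
rewrite -{}E mulr_sumr.
have hw : (n.+1 <= (l + n).+1)%N by rewrite ltnS leq_addl.
rewrite (big_ord_widen _ (fun k : nat =>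
  (l`! * n.+1`!)%:R^-1 * ('C(n.+1, k)%:R * bernoulli R k)) hw).
rewrite [RHS]big_mkcond /=; apply: eq_bigr => k _.
have -> : (l < (l + n).+1 - k)%N = (k < n.+1)%N by have := ltn_ord k; lia.
case: ifP => hk; last by rewrite mulr0.
have hk' : (k <= n.+1)%N by lia.
have hl : (l <= (l + n).+1 - k)%N by lia.
rewrite -(bin_fact hl) (_ : (l + n).+1 - k - l = n.+1 - k)%N; last by lia.
have e := bin_fact hk'; rewrite -e !natrM.
have h1 := fact_neq0 R l; have h2 := fact_neq0 R k; have h3 := fact_neq0 R (n.+1 - k).
have h4 : 'C(n.+1, k)%:R != 0 :> R by rewrite pnatr_eq0 -lt0n bin_gt0.
have h5 : 'C((l + n).+1 - k, l)%:R != 0 :> R by rewrite pnatr_eq0 -lt0n bin_gt0.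
by field; rewrite h1 h2 h3 h4 h5.
Qed.

Lemma faulhaber0 (R : realType) (n : nat) : (faulhaber R n).[0] = 0.
Proof.
rewrite horner_sum big1 // => k _; rewrite hornerZ hornerXn expr0n.
by rewrite subn_eq0 leqNgt ltn_ord mulr0.
Qed.

Lemma regsum_faulhaber (R : realType) (n : nat) (z : R) : z != 1 ->
  (1 - z) * regsum z (faulhaber R n) = z * regsum z (divpow R n).
Proof.
move=> z1; have := regsum_shift (faulhaber R n) z1; rewrite faulhaber0 add0r.
have -> : faulhaber R n \Po ('X + 1) = divpow R n + faulhaber R n.
  by rewrite -fdiff_faulhaber /fdiff subrK.
rewrite linearD /= mulrBl mul1r mulrDr => {1}->; ring.
Qed.

(** * Partial fractions and spanning families *)

(** Uniqueness of partial fractions with simple poles, tested off a finite set only. Clearing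
    denominators gives a polynomial identity, and its value at s_i retains the single term with
    c_i. *)
Lemma sum_poles_eq0 (R : realType) (I : finType) (s : I -> R) (c : I -> R)
    (g : {poly R}) (bad : seq R) :
  injective s ->
  (forall z, z \notin bad -> (forall i, z != s i) ->
     g.[z] + \sum_i c i / (z - s i) = 0) ->
  (forall i, c i = 0) /\ g = 0.
Proof.
move=> s_inj h.
pose P i := \prod_(j | j != i) ('X - (s j)%:P).
have P0 i : (P i).[s i] != 0.
  rewrite horner_prod; apply/prodf_neq0 => j ji.
  by rewrite hornerXsubC subr_eq0 (inj_eq s_inj) eq_sym.
have PQ i : \prod_j ('X - (s j)%:P) = ('X - (s i)%:P) * P i by rewrite (bigD1 i).
have Q0 : g * \prod_i ('X - (s i)%:P) + \sum_i c i *: P i = 0.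
  apply: (@poly0_cofinite _ _ (bad ++ codom s)) => z.
  rewrite mem_cat negb_or => /andP[zb zs].
  have zsi i : z != s i by apply: contra zs => /eqP ->; apply: codom_f.
  rewrite hornerD hornerM horner_sum.
  transitivity ((g.[z] + \sum_i c i / (z - s i)) * (\prod_i ('X - (s i)%:P)).[z]);
    last by rewrite h // mul0r.
  rewrite mulrDl mulr_suml; congr (_ + _); apply: eq_bigr => i _.
  by rewrite hornerZ (PQ i) hornerM hornerXsubC mulrA divfK // subr_eq0.
have c0 i : c i = 0.
  have := congr1 (horner^~ (s i)) Q0.
  rewrite hornerD hornerM (PQ i) hornerM hornerXsubC subrr mul0r mulr0 add0r.
  rewrite horner_sum (bigD1 i) //= big1 ?addr0 => [|j ji].
    by rewrite hornerZ horner0 => /eqP; rewrite mulf_eq0 (negPf (P0 i)) orbF => /eqP.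
  rewrite hornerZ /P (bigD1 i) 1?eq_sym //=.
  by rewrite hornerM hornerXsubC subrr mul0r mulr0.
split=> //; move: Q0; rewrite [X in _ + X]big1 => [|i _]; last by rewrite c0 scale0r.
move=> /eqP; rewrite addr0 mulf_eq0 => /orP[/eqP //|].
by rewrite (negPf (monic_neq0 (monic_prod_XsubC _ _ _))).
Qed.

Lemma sum_option (V : nmodType) (J : finType) (F : option J -> V) :
  \sum_i F i = F None + \sum_j F (Some j).
Proof.
rewrite (bigD1 None) //=; congr (_ + _).
rewrite (reindex_omap Some id) => [|[j|] //].
by apply: eq_bigl => j; rewrite /= eqxx.
Qed.

(** The family has as many members as the dimension, so its matrix is square and independence makes
    it invertible. *)
Lemma free_span (F : fieldType) (I : finType) (v : I -> 'rV[F]_#|I|) :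
  (forall c : I -> F, \sum_i c i *: v i = 0 -> forall i, c i = 0) ->
  forall w, exists c : I -> F, w = \sum_i c i *: v i.
Proof.
move=> hfree w; pose M := \matrix_(i < #|I|) v (enum_val i).
have MP (u : 'rV_#|I|) : u *m M = \sum_i u 0 (enum_rank i) *: v i.
  rewrite mulmx_sum_row (reindex_onto enum_rank enum_val) /=; last first.
    by move=> i _; rewrite enum_valK.
  by apply: eq_big => i; rewrite ?enum_rankK ?eqxx // => _; rewrite rowK enum_rankK.
have Mu : row_free M.
  apply: inj_row_free => u; rewrite MP => /hfree h.
  by apply/rowP => i; rewrite mxE -(enum_valK i) h.
exists (fun i => (w *m invmx M) 0 (enum_rank i)).
by rewrite -MP mulmxKV // -row_free_unit.
Qed.

(** * Decomposition of generating functions *)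

Lemma size_divpow (R : realType) n : (size (divpow R n) <= n.+1)%N.
Proof. by rewrite (leq_trans (size_scale_leq _ _)) // size_polyXn. Qed.

Lemma size_revsum (R : realType) (c : nat -> R) (D n : nat) :
  (size (\sum_(k < D) c k *: 'X^(n - k))%R <= n.+1)%N.
Proof.
rewrite (leq_trans (size_sum _ _ _)) //; apply/bigmax_leqP => k _.
by rewrite (leq_trans (size_scale_leq _ _)) // size_polyXn ltnS leq_subr.
Qed.

Lemma size_faulhaber (R : realType) n : (size (faulhaber R n) <= n.+2)%N.
Proof. exact: (size_revsum (fun k => bernoulli R k / (k`! * (n.+1 - k)`!)%:R)). Qed.

Lemma size_regpoly (R : realType) n (r : R) : (size (regpoly n r) <= n.+1)%N.
Proof. exact: (size_revsum (fun k => regsum r 'X^k / (k`! * (n - k)`!)%:R)). Qed.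

(** The arguments [kap], [a] and [c] are coordinates with respect to P, Y and the y_r. *)
Definition regcomb (R : realType) (J : finType) (r : J -> R) (n : nat)
    (kap a : R) (c : J -> R) : {poly R} :=
  kap *: divpow R n + a *: faulhaber R n + \sum_j c j *: regpoly n (r j).

Lemma size_regcomb (R : realType) (J : finType) (r : J -> R) (n : nat)
    (kap a : R) (c : J -> R) : (size (regcomb r n kap a c) <= n.+2)%N.
Proof.
have hs (b : R) (u : {poly R}) : (size u <= n.+2)%N -> (size (b *: u)%R <= n.+2)%N.
  exact/leq_trans/size_scale_leq.
rewrite (leq_trans (size_polyD _ _)) // geq_max; apply/andP; split.
  rewrite (leq_trans (size_polyD _ _)) // geq_max; apply/andP; split; apply: hs.
    exact: leqW (size_divpow _ _).
  exact: size_faulhaber.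
rewrite (leq_trans (size_sum _ _ _)) //; apply/bigmax_leqP => k _.
exact/hs/leqW/size_regpoly.
Qed.

Lemma regcomb0 (R : realType) (J : finType) (r : J -> R) (n : nat)
    (kap a : R) (c : J -> R) :
  (0 < n)%N -> (forall j, regsum (r j) 'X^n = 0) ->
  (regcomb r n kap a c).[0] = 0.
Proof.
move=> n0 hr; rewrite 2!hornerD (hornerZ kap) (hornerZ a) faulhaber0.
rewrite hornerZ hornerXn expr0n gtn_eqF // !mulr0 !add0r horner_sum big1 // => j _.
by rewrite hornerZ regpoly0 linearZ /= hr !mulr0.
Qed.

Lemma regsum_regcomb (R : realType) (J : finType) (r : J -> R) (n : nat)
    (kap a : R) (c : J -> R) (z : R) :
  (forall j, r j != 1) -> (forall j, regsum (r j) 'X^n = 0) ->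
  z != 1 -> (forall j, z != r j) ->
  regsum z (regcomb r n kap a c)
  = (kap + a * (z / (1 - z)) + \sum_j c j * (z / (z - r j)))
    * regsum z (divpow R n).
Proof.
move=> r1 hr z1 zr; rewrite /regcomb !linearD /=.
rewrite (regsumZ z kap) (regsumZ z a) [X in _ + X]linear_sum !mulrDl mulr_suml.
have z1' : 1 - z != 0 by rewrite subr_eq0 eq_sym.
congr (_ + _ + _).
  by rewrite -mulrA; congr (_ * _); apply: (mulfI z1'); rewrite regsum_faulhaber //; field.
apply: eq_bigr => j _; rewrite linearZ /= -mulrA; congr (_ * _).
have zrj : z - r j != 0 by rewrite subr_eq0.
by apply: (mulfI zrj); rewrite regsum_regpoly //; field.
Qed.

(** Separates the constant from the principal parts, as [sum_poles_eq0] requires: z / (1 - z) = - 1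
    - 1 / (z - 1) and z / (z - r) = 1 + r / (z - r). *)
Lemma poles_eq (R : realType) (J : finType) (r : J -> R) (kap a z : R)
    (c : J -> R) : z != 1 -> (forall j, z != r j) ->
  kap + a * (z / (1 - z)) + \sum_j c j * (z / (z - r j))
  = (kap - a + \sum_j c j) + (- a / (z - 1) + \sum_j (c j * r j) / (z - r j)).
Proof.
move=> z1 zr; have z1' : 1 - z != 0 by rewrite subr_eq0 eq_sym.
have z1'' : z - 1 != 0 by rewrite subr_eq0.
rewrite [RHS]addrACA -big_split /=; congr (_ + _); first by field; rewrite z1' z1''.
apply: eq_bigr => j _; have zrj : z - r j != 0 by rewrite subr_eq0.
by field.
Qed.

(** A dimension count: the polynomials of degree at most n + 1 vanishing at 0 have dimension n + 1 =
    #|J| + 2, the number of generators. Their independence is that of distinct partial fractions. *)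
Lemma regcomb_exists (R : realType) (J : finType) (r : J -> R) (n : nat)
    (bad : seq R) (u : {poly R}) :
  #|J|.+1 = n -> injective r -> (forall j, r j != 0) -> (forall j, r j != 1) ->
  (forall j, regsum (r j) 'X^n = 0) ->
  (forall z, z \notin bad -> regsum z 'X^n != 0) ->
  (size u <= n.+2)%N -> u.[0] = 0 ->
  exists kap a c, u = regcomb r n kap a c.
Proof.
move=> hJ r_inj r0 r1 hr hbad hu u0.
have n0 : (0 < n)%N by rewrite -hJ.
pose I := option (option J).
have cI : #|{: I}| = n.+1 by rewrite !card_option hJ.
pose b (i : I) := match i with
  | None => divpow R n | Some None => faulhaber R n
  | Some (Some j) => regpoly n (r j) end.
(* Dropping the constant coefficient loses nothing for polynomials with a prescribed value at 0. *)
pose row (p : {poly R}) : 'rV[R]_#|{: I}| := \row_k p`_k.+1.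
have bE (c : I -> R) : \sum_i c i *: row (b i)
    = row (regcomb r n (c None) (c (Some None)) (fun j => c (Some (Some j)))).
  apply/rowP => k; rewrite summxE mxE.
  transitivity ((\sum_i c i *: b i)`_k.+1).
    by rewrite coef_sum; apply: eq_bigr => i _; rewrite !mxE coefZ.
  by rewrite sum_option /= sum_option /= addrA.
have row_inj (p1 p2 : {poly R}) : (size p1 <= n.+2)%N -> (size p2 <= n.+2)%N ->
    p1.[0] = p2.[0] -> row p1 = row p2 -> p1 = p2.
  move=> h1 h2 h0 h; apply/polyP => -[|k]; first by rewrite -!horner_coef0.
  have [hk|hk] := ltnP k #|{: I}|.
    by have /rowP/(_ (Ordinal hk)) := h; rewrite !mxE.
  by rewrite !nth_default // ?(leq_trans h1) ?(leq_trans h2) // -cI.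
have hfree (c : I -> R) : \sum_i c i *: row (b i) = 0 -> forall i, c i = 0.
  rewrite bE => h.
  have {}h : regcomb r n (c None) (c (Some None)) (fun j => c (Some (Some j))) = 0.
    apply: row_inj; rewrite ?size_regcomb ?size_poly0 ?regcomb0 ?horner0 //.
    by rewrite h; apply/rowP => k; rewrite !mxE coef0.
  pose s (i : option J) := if i is Some j then r j else 1.
  have s_inj : injective s.
    move=> [i|] [j|] //=; first by move=> /r_inj ->.
    - by move=> /eqP; rewrite (negPf (r1 _)).
    - by move=> /eqP; rewrite eq_sym (negPf (r1 _)).
  pose d (i : option J) := if i is Some j then c (Some (Some j)) * r j else - c (Some None).
  pose g := (c None - c (Some None) + \sum_j c (Some (Some j)))%:P.
  have [|d0 g0] := @sum_poles_eq0 _ _ s d g bad s_inj.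
    move=> z zb zs; have z1 := zs None; have zr j := zs (Some j).
    rewrite hornerC sum_option /= -poles_eq //.
    (* Cancelling [regsum z P], nonzero off [bad], turns the vanishing combination into a vanishing
       partial fraction. *)
    apply: (@mulIf _ (regsum z (divpow R n))).
      by rewrite linearZ /= mulf_neq0 ?hbad // invr_eq0 fact_neq0.
    by rewrite -regsum_regcomb // h linear0 mul0r.
  have c2 j : c (Some (Some j)) = 0.
    by have /eqP := d0 (Some j); rewrite /= mulf_eq0 (negPf (r0 j)) orbF => /eqP.
  have c1 : c (Some None) = 0 by have /eqP := d0 None; rewrite /= oppr_eq0 => /eqP.
  have c0 : c None = 0.
    move: g0; rewrite /g c1 subr0 big1 // addr0 => /eqP.
    by rewrite polyC_eq0 => /eqP.
  by move=> [[j|]|].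
have [c hc] := free_span hfree (row u).
exists (c None), (c (Some None)), (fun j => c (Some (Some j))).
by apply: row_inj; rewrite ?size_regcomb ?regcomb0 // hc bE.
Qed.

(** * The generating function of the coefficients *)

(** The equations at the nodes b are multiplied by z^b and added. Both sides are finite sums of
    polynomial values, which [regsum_sum] and reflection convert into regularized sums at z and
    1/z. *)
Lemma genfun_identity (R : realType) (n N : nat) (c : nat -> R)
    (W : {poly R}) (z : R) :
  odd n -> z != 0 -> z != 1 ->
  (forall b, (b <= N)%N ->
     \sum_(g < N.+1) c g * (if (b < g)%N then (g%:R - b%:R) ^+ n / n`!%:R else 0)
     = W.[b%:R]) ->
  (\sum_(g < N.+1) c g * z ^+ g) * regsum z (divpow R n)
  = regsum z (W - \sum_(g < N.+1) c g *: (divpow R n \Po (g%:R%:P - 'X)))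
    + z ^+ N * regsum z^-1 (W \Po (N%:R%:P - 'X)).
Proof.
move=> on z0 z1 hW; set P := divpow R n.
(* The tail beyond N is the reflection of W(N - x), hence a regularized sum at 1/z. *)
have e1 : \sum_(b < N.+1) W.[b%:R] * z ^+ b
    = regsum z W + z ^+ N * regsum z^-1 (W \Po (N%:R%:P - 'X)).
  rewrite regsum_sum //; have -> : W \Po ('X + N.+1%:R%:P)
      = (W \Po (N%:R%:P - 'X)) \Po (- 'X - 1).
    rewrite -comp_polyA comp_polyB comp_polyC comp_polyX -natr1 polyCD polyC1.
    by move: (N%:R)%:P => a; congr (comp_poly _ _); rewrite opprD !opprK addrCA.
  by rewrite regsum_reflect // exprS; field.
(* Here the tail beyond g is a multiple of [regsum z^-1 P], which for odd n equals [regsum z P];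
   thus the generating function of c factors out. *)
have e2 g : (g <= N)%N ->
    \sum_(b < N.+1) (if (b < g)%N then (g%:R - b%:R) ^+ n / n`!%:R else 0) * z ^+ b
    = regsum z (P \Po (g%:R%:P - 'X)) + z ^+ g * regsum z P.
  move=> hg; transitivity (\sum_(b < g) (P \Po (g%:R%:P - 'X)).[b%:R] * z ^+ b).
    rewrite (big_ord_widen _ (fun b : nat => (P \Po (g%:R%:P - 'X)).[b%:R] * z ^+ b)
      (leqW hg)) [RHS]big_mkcond; apply: eq_bigr => b _.
    case: ifP => _; last by rewrite mul0r.
    by rewrite horner_comp hornerD hornerN hornerC hornerX /P hornerZ hornerXn (mulrC _^-1).
  rewrite regsum_sum // -comp_polyA comp_polyB comp_polyC comp_polyX opprD addrCA subrr addr0.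
  rewrite regsum_opp // /P (regsumZ z^-1) regsumXn_inv // -regsumZ.
  by rewrite hornerZ hornerXn expr0n; case: (n) on => // k _ /=; rewrite mulr0 sub0r; ring.
rewrite linearB /= addrAC -e1 mulr_suml [regsum z (\sum_(g < _) _)]linear_sum /=.
apply/eqP; rewrite eq_sym subr_eq -big_split /=; apply/eqP.
transitivity (\sum_(b < N.+1) \sum_(g < N.+1) c g *
   ((if (b < g)%N then (g%:R - b%:R) ^+ n / n`!%:R else 0) * z ^+ b)).
  apply: eq_bigr => b _; rewrite -hW ?mulr_suml; last by rewrite -ltnS.
  by apply: eq_bigr => g _; rewrite mulrA.
rewrite exchange_big; apply: eq_bigr => g _; rewrite /= -mulr_sumr e2; last by rewrite -ltnS.
by rewrite [in RHS]regsumZ; ring.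
Qed.

Lemma coef_faulhaber (R : realType) (n j : nat) : (j <= n)%N ->
  (faulhaber R n)`_(n.+1 - j) = bernoulli R j / (j`! * (n.+1 - j)`!)%:R.
Proof.
move=> hj.
apply: (coef_revsum (fun k => bernoulli R k / (k`! * (n.+1 - k)`!)%:R)); lia.
Qed.

Lemma coef_regpoly (R : realType) (n j : nat) (r : R) : (j <= n)%N ->
  (regpoly n r)`_(n - j) = regsum r 'X^j / (j`! * (n - j)`!)%:R.
Proof.
move=> hj.
apply: (coef_revsum (fun k => regsum r 'X^k / (k`! * (n - k)`!)%:R)); lia.
Qed.

(** Indexed by the codegree j, since the coefficient of degree n - j involves exactly B_(j+1) and
    the regularized sums of x^j that occur in the system for d. *)
Lemma coef_regcomb (R : realType) (J : finType) (r : J -> R) (n j : nat)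
    (kap a : R) (c : J -> R) : (j < n)%N ->
  (regcomb r n kap a c)`_(n - j) * (j`! * (n - j)`!)%:R
  = kap * (j == 0%N)%:R + a * (bernoulli R j.+1 / j.+1%:R)
    + \sum_i c i * regsum (r i) 'X^j.
Proof.
move=> hj; have fn0 := @fact_neq0 R; rewrite 2!coefD coef_sum 2!mulrDl mulr_suml.
congr (_ + _ + _).
- rewrite (coefZ kap) coefZ coefXn (_ : (n - j == n)%N = (j == 0)%N); last by lia.
  by case: j hj => [|j] hj; rewrite /= ?mulr0 ?mul0r // subn0 fact0 mul1n; field.
- rewrite (coefZ a) -subSS coef_faulhaber //.
  rewrite subSS factS !natrM.
  by field; rewrite !fn0 nat1r pnatr_eq0.
apply: eq_bigr => i _.
rewrite (coefZ (c i)) coef_regpoly 1?ltnW //.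
by rewrite !natrM; field; rewrite !fn0.
Qed.

Lemma lead_regcomb (R : realType) (J : finType) (r : J -> R) (n : nat)
    (kap a : R) (c : J -> R) :
  (regcomb r n kap a c)`_n.+1 = a / (n.+1)`!%:R.
Proof.
rewrite 2!coefD coef_sum [X in _ + X]big1 => [|i _]; last first.
  by rewrite (coefZ (c i)) nth_default ?mulr0 // size_regpoly.
rewrite (coefZ kap) nth_default ?size_divpow // mulr0 add0r addr0.
have := coef_faulhaber R (leq0n n); rewrite subn0 fact0 mul1n => e.
by rewrite (coefZ a) e /bernoulli /= mul1r.
Qed.

Lemma regsum1 (R : realType) (z : R) : regsum z 1 = (1 - z)^-1.
Proof. by rewrite /regsum size_poly1 big_ord1 /= hornerC expr0 expr1 !mul1r. Qed.

(** Generating function of the claimed coefficients, with end coefficient [kap], in closed form for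
    comparison with the partial fractions. The hypotheses on z keep the denominators of the
    geometric sums nonzero. *)
Lemma geometric_poly (R : realType) (I : finType) (q d : I -> R) (N : nat)
    (kap z : R) :
  (0 < N)%N -> z != 1 -> (forall k, q k * z != 1) -> (forall k, z != q k) ->
  \sum_(b < N.+1) (if (b == 0%N :> nat) || (b == N :> nat) then kap
                   else 1 + \sum_k d k * (q k ^+ b + q k ^+ (N - b))) * z ^+ b
  = kap * (1 + z ^+ N) + (z - z ^+ N) / (1 - z)
    + \sum_k d k * ((q k * z - (q k * z) ^+ N) / (1 - q k * z)
                    + q k * z * (z ^+ N.-1 - q k ^+ N.-1) / (z - q k)).
Proof.
case: N => // N _ z1 qz1 zq; rewrite [N.+1.-1]/=.
have geo (x : R) M : x != 1 -> \sum_(i < M) x ^+ i.+1 = (x - x ^+ M.+1) / (1 - x).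
  move=> x1; have x1' : 1 - x != 0 by rewrite subr_eq0 eq_sym.
  apply: (mulIf x1'); rewrite divfK //; elim: M => [|M IH].
    by rewrite big_ord0; ring.
  by rewrite big_ord_recr /= mulrDl IH !exprS; ring.
have geo2 (x : R) M : z != x ->
    \sum_(i < M) x ^+ (M - i) * z ^+ i.+1 = x * z * (z ^+ M - x ^+ M) / (z - x).
  move=> zx; have zx' : z - x != 0 by rewrite subr_eq0.
  apply: (mulIf zx'); rewrite divfK //; elim: M => [|M IH].
    by rewrite big_ord0; ring.
  rewrite big_ord_recr /= subSnn expr1.
  rewrite (eq_bigr (fun i : 'I_M => x * (x ^+ (M - i) * z ^+ i.+1))); last first.
    by move=> i _; rewrite subSn ?exprS ?mulrA // ltnW.
  by rewrite -mulr_sumr mulrDl -(mulrA x (\sum_(i < M) _)) IH !exprS; ring.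
rewrite big_ord_recl big_ord_recr /= expr0 mulr1.
have bump0 i : bump 0 i = i.+1 by rewrite /bump add1n.
rewrite !bump0 eqxx mulrDr mulr1.
rewrite (eq_bigr (fun i : 'I_N => z ^+ i.+1
    + \sum_k d k * ((q k * z) ^+ i.+1 + q k ^+ (N - i) * z ^+ i.+1))); last first.
  move=> i _; rewrite bump0 eqSS ltn_eqF // subSS mulrDl mul1r mulr_suml.
  by congr (_ + _); apply: eq_bigr => k _; rewrite -mulrA mulrDl exprMn.
rewrite big_split /= geo // exchange_big /= (eq_bigr (fun k => d k *
    ((q k * z - (q k * z) ^+ N.+1) / (1 - q k * z) +
      q k * z * (z ^+ N - q k ^+ N) / (z - q k)))); first by ring.
by move=> k _; rewrite -mulr_sumr big_split /= geo // geo2.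
Qed.

(** Contribution of one root, with a = z^(N-1) and b = q^(N-1). The claimed generating function
    minus the actual one has a polynomial part and poles at q and 1/q, all proportional to t + d
    q^N. *)
Lemma residue_identity (R : realType) (q z a b d t : R) :
  q != 0 -> z != 0 -> b != 0 -> z != q -> z != q^-1 ->
  d * ((q * z - (q * b) * (z * a)) / (1 - q * z) + q * z * (a - b) / (z - q))
  - (t * (z / (z - q)) - d * (z / (z - q^-1)))
  - z * a * (t * (z^-1 / (z^-1 - q)) - d * (z^-1 / (z^-1 - q^-1)))
  + (t + d * (q * b)) * (1 - q^-1 * (((q * b)^-1 - z * a) / (q^-1 - z)))
  + ((t + d * (q * b)) * q / (z - q)
     + (- (t + d * (q * b)) * q^-1 * (q * b)^-1) / (z - q^-1)) = 0.
Proof.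
move=> q0 z0 b0 zq zqV.
have h1 : z - q != 0 by rewrite subr_eq0.
have h2 : z * q - 1 != 0.
  by rewrite subr_eq0; apply: contra zqV => /eqP h; rewrite -[z](mulfK q0) h mul1r.
have h3 : 1 + - z * q != 0 by rewrite mulNr -opprB oppr_eq0.
have h4 : q + -1 * z != 0 by rewrite mulN1r -opprB oppr_eq0.
by field; rewrite q0 h2 b0 h1 h3 z0 h4.
Qed.

Lemma bernoulli1 (R : realType) : bernoulli R 1 / 1 = - 2^-1.
Proof. by rewrite divr1 /bernoulli /= big_ord1 /= bin0 mul1r mulN1r. Qed.

Lemma coefs_of_genfun (R : realType) (m N : nat) (q : 'I_m.-1 -> R)
    (c : nat -> R) (u : {poly R}) (bad : seq R) :
  (0 < m)%N -> (0 < N)%N -> injective q ->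
  (forall k, q k != 0) -> (forall k, `|q k| < 1) ->
  (forall k, regsum (q k) 'X^(2 * m - 1) = 0) ->
  (forall z, z \notin bad -> regsum z 'X^(2 * m - 1) != 0) ->
  (size u <= (2 * m).+1)%N -> u.[0] = 0 -> u`_(2 * m) = (2 * m)`!%:R^-1 ->
  (forall i, (m <= i < 2 * m)%N -> u`_i = 0) ->
  (forall z, z != 0 -> z != 1 ->
     (\sum_(g < N.+1) c g * z ^+ g) * regsum z (divpow R (2 * m - 1))
     = regsum z u + z ^+ N * regsum z^-1 u) ->
  exists d : 'I_m.-1 -> R,
  [/\ forall j, (1 <= j <= m.-1)%N ->
        \sum_k d k * (regsum (q k)^-1 'X^j + q k ^+ N * regsum (q k) 'X^j)
        = bernoulli R j.+1 / j.+1%:R,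
      forall b, (b == 0%N) || (b == N) ->
        c b = 2^-1 - \sum_k d k * ((q k - q k ^+ N) / (1 - q k))
    & forall b, (0 < b < N)%N ->
        c b = 1 + \sum_k d k * (q k ^+ b + q k ^+ (N - b))].
Proof.
case: m q => // m; rewrite [m.+1.-1]/= => q _; set n := (2 * m.+1 - 1)%N.
have n1 : (2 * m.+1)%N = n.+1 by rewrite /n; lia.
rewrite n1 => N0 q_inj q0 q_lt1 hq hbad hu u0 ulead umid gen.
have on : odd n by rewrite /n mulnS; lia.
have q1 k : q k != 1.
  by apply/eqP => e; have := q_lt1 k; rewrite e normr1 ltxx.
have qV1 k : (q k)^-1 != 1 by rewrite invr_eq1.
have qq k l : q k != (q l)^-1.
  apply/eqP => e; have := q_lt1 k; rewrite e normfV invf_lt1 ?normr_gt0 //.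
  by have := q_lt1 l; lra.
(* The tag [true] marks a root inside the disc, [false] its reciprocal. After the case analysis [m]
   counts these pairs, so that n = 2m + 1. *)
pose r (i : 'I_m * bool) := if i.2 then q i.1 else (q i.1)^-1.
have r_inj : injective r.
  move=> [k []] [l []]; rewrite /r /=.
  - by move=> /q_inj ->.
  - by move=> /eqP; rewrite (negPf (qq _ _)).
  - by move=> /eqP; rewrite eq_sym (negPf (qq _ _)).
  - by move=> /invr_inj /q_inj ->.
have r0 i : r i != 0 by rewrite /r; case: ifP; rewrite ?invr_eq0.
have r1 i : r i != 1 by rewrite /r; case: ifP.
have hr i : regsum (r i) 'X^n = 0.
  by rewrite /r; case: ifP => // _; rewrite regsumXn_inv.
have rV i : exists j, r j = (r i)^-1.
  by exists (i.1, ~~ i.2); rewrite /r /=; case: i.2; rewrite /= ?invrK.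
have cardJ : #|{: 'I_m * bool}|.+1 = n.
  by rewrite card_prod card_ord card_bool /n; lia.
have [kap [a [cc eu]]] := regcomb_exists cardJ r_inj r0 r1 hr hbad hu u0.
(* Only Y reaches degree n + 1, so the leading coefficient of u determines [a]. *)
have a1 : a = 1.
  move: ulead; rewrite eu lead_regcomb => /(congr1 (fun x => x * n.+1`!%:R)).
  by rewrite mulfVK ?fact_neq0 // mulVf ?fact_neq0.
have sumJ (F : 'I_m * bool -> R) : \sum_i F i = \sum_k (F (k, true) + F (k, false)).
  rewrite (eq_bigr (fun i => F (i.1, i.2))) => [|[] //].
  rewrite -(pair_bigA _ (fun k b => F (k, b))) /=.
  by apply: eq_bigr => k _; rewrite big_bool.
(* The degrees n - j with j <= m are those in which [umid] makes u vanish. *)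
have coefE j : (j <= m)%N ->
    kap * (j == 0%N)%:R + bernoulli R j.+1 / j.+1%:R
    + \sum_k (cc (k, true) * regsum (q k) 'X^j + cc (k, false) * regsum (q k)^-1 'X^j) = 0.
  move=> hj; have jn : (j < n)%N by rewrite /n; lia.
  have := coef_regcomb r kap a cc jn; rewrite -eu umid; last by rewrite /n; lia.
  by rewrite mul0r a1 mul1r sumJ => <-.
pose d k := - cc (k, false).
(* The common factor of the residues at q_k and 1/q_k of the difference of two polynomials, hence
   bound to vanish. *)
pose e k := cc (k, true) + d k * q k ^+ N.
pose G := \poly_(b < N.+1) (if (b == 0%N) || (b == N) then kap
                     else 1 + \sum_k d k * (q k ^+ b + q k ^+ (N - b))).
pose Cp := \poly_(b < N.+1) c b.
have [e0 GC] : (forall k, e k = 0) /\ G = Cp.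
  (* [H k] is the quotient of q_k^-N - z^N by q_k^-1 - z. It absorbs the factor z^N at the pole
     1/q_k, so that [g] is a polynomial and the residues [f] are constants. *)
  pose H k : {poly R} := \sum_(i < N) (q k)^-1 ^+ (N.-1 - i) *: 'X^i.
  pose g := G - Cp + \sum_k e k *: (1 - (q k)^-1 *: H k).
  pose f (i : 'I_m * bool) := if i.2 then e i.1 * q i.1
                              else - e i.1 * (q i.1)^-1 * (q i.1)^-1 ^+ N.
  have [|f0 g0] := @sum_poles_eq0 _ _ r f g (0 :: 1 :: bad) r_inj.
    move=> z; rewrite !inE !negb_or => /and3P[z0 z1 zb] zr.
    have zq k : z != q k by exact: (zr (k, true)).
    have zqV k : z != (q k)^-1 by exact: (zr (k, false)).
    have zV1 : z^-1 != 1 by rewrite invr_eq1.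
    have zVr i : z^-1 != r i.
      by have [j hj] := rV i; rewrite -(inj_eq invr_inj) invrK -hj.
    have P0 : regsum z (divpow R n) != 0.
      by rewrite regsumZ mulf_neq0 ?hbad // invr_eq0 fact_neq0.
    have Pinv : regsum z^-1 (divpow R n) = regsum z (divpow R n).
      by rewrite !regsumZ regsumXn_inv.
    have CE : Cp.[z] = (kap + z / (1 - z)
          + \sum_k (cc (k, true) * (z / (z - q k)) + cc (k, false) * (z / (z - (q k)^-1))))
        + z ^+ N * (kap + z^-1 / (1 - z^-1)
          + \sum_k (cc (k, true) * (z^-1 / (z^-1 - q k))
                    + cc (k, false) * (z^-1 / (z^-1 - (q k)^-1)))).
      apply: (mulIf P0); rewrite horner_poly gen // eu !regsum_regcomb // a1 !mul1r.
      by rewrite Pinv !sumJ /=; ring.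
    rewrite /g !hornerD hornerN CE.
    have GE : G.[z] = kap * (1 + z ^+ N) + (z - z ^+ N) / (1 - z)
        + \sum_k d k * ((q k * z - (q k * z) ^+ N) / (1 - q k * z)
                        + q k * z * (z ^+ N.-1 - q k ^+ N.-1) / (z - q k)).
      rewrite horner_poly geometric_poly // => k; apply: contra (zqV k) => /eqP h.
      by rewrite -[z](mulKf (q0 k)) h mulr1.
    rewrite {}GE; have HE k : (H k).[z] = ((q k)^-1 ^+ N - z ^+ N) / ((q k)^-1 - z).
      have hk : (q k)^-1 - z != 0 by rewrite subr_eq0 eq_sym.
      apply: (mulIf hk); rewrite divfK // subrXX mulrC; congr (_ * _).
      by rewrite horner_sum; apply: eq_bigr => i _; rewrite hornerZ hornerXn.
    have -> : (\sum_k e k *: (1 - (q k)^-1 *: H k)).[z]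
        = \sum_k e k * (1 - (q k)^-1 * (((q k)^-1 ^+ N - z ^+ N) / ((q k)^-1 - z))).
      rewrite horner_sum; apply: eq_bigr => k _.
      by rewrite hornerZ hornerD hornerN hornerC hornerZ HE.
    have z1' : 1 - z != 0 by rewrite subr_eq0 eq_sym.
    have z1'' : z - 1 != 0 by rewrite subr_eq0.
    have -> : (z - z ^+ N) / (1 - z) = z / (1 - z) + z ^+ N * (z^-1 / (1 - z^-1)).
      by field; rewrite z0 z1' z1''.
    rewrite sumJ /=.
    set S1 := (X in _ + _ + X - _); set S2 := (X in _ - (_ + X + _)).
    set S3 := (X in _ - (_ + _ * (_ + X))); set S4 := (X in _ - _ + X + _).
    set S5 := (X in _ + X = 0).
    have -> : forall A B : R, kap * (1 + z ^+ N) + (A + z ^+ N * B) + S1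
        - (kap + A + S2 + z ^+ N * (kap + B + S3)) + S4 + S5
        = S1 - S2 - z ^+ N * S3 + S4 + S5.
      by move=> A B; ring.
    rewrite /S3 mulr_sumr -!sumrB -!big_split /= big1 // => k _.
    have bn0 : q k ^+ N.-1 != 0 by rewrite expf_neq0.
    have eN (x : R) : x ^+ N = x * x ^+ N.-1 by rewrite -exprS prednK.
    rewrite -[RHS](residue_identity (z ^+ N.-1) (d k) (cc (k, true)) (q0 k) z0
      bn0 (zq k) (zqV k)) /f /r /= /e exprMn exprVn !eN /d; ring.
  have e0 k : e k = 0.
    by have /eqP := f0 (k, true); rewrite /f /= mulf_eq0 (negPf (q0 k)) orbF => /eqP.
  split=> //; apply/eqP; rewrite -subr_eq0 -g0 /g big1 ?addr0 // => k _.
  by rewrite e0 scale0r.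
have cE b : (b <= N)%N -> c b = if (b == 0%N) || (b == N) then kap
                     else 1 + \sum_k d k * (q k ^+ b + q k ^+ (N - b)).
  by move=> hb; have := congr1 (fun p : {poly R} => p`_b) GC; rewrite !coef_poly ltnS hb.
have ccE k : cc (k, true) = - (d k * q k ^+ N).
  by apply/eqP; rewrite -addr_eq0; apply/eqP/e0.
have ccF k : cc (k, false) = - d k by rewrite opprK.
exists d; split.
- move=> j /andP[j1 jm]; have := coefE j jm; rewrite gtn_eqF // mulr0 add0r.
  move=> /eqP; rewrite addr_eq0 -sumrN => /eqP ->.
  by apply: eq_bigr => k _; rewrite ccE ccF; ring.
- move=> b hb; rewrite cE ?hb; last by case/orP: hb => /eqP ->.
  (* Codegree 0 determines [kap]; the 1/2 in the end coefficients is - B_1. *)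
  have := coefE 0%N isT; rewrite eqxx mulr1 bernoulli1 expr0.
  rewrite (eq_bigr (fun k => d k * ((q k - q k ^+ N) / (1 - q k)))); first lra.
  move=> k _; rewrite ccE ccF !regsum1.
  have h : 1 - q k != 0 by rewrite subr_eq0 eq_sym.
  have h' : q k - 1 != 0 by rewrite subr_eq0.
  by field; rewrite h h' q0.
by move=> b /andP[b0 bN]; rewrite cE ?(ltnW bN) // gtn_eqF // ltn_eqF.
Qed.

(** * Euler-Frobenius polynomials *)

Lemma derivable_regsum (R : realType) (p : {poly R}) (x : R) : x != 1 ->
  derivable (fun z => regsum z p) x 1.
Proof.
move=> x1; rewrite /regsum.
have -> : (fun z => \sum_(i < size p) (iter i (@fdiff R) p).[0] * (z ^+ i / (1 - z) ^+ i.+1))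
   = \sum_(i < size p) ((fun z : R =>
       (iter i (@fdiff R) p).[0] * (z ^+ i / (1 - z) ^+ i.+1)) : R -> R).
  by apply/funext => z; rewrite fct_sumE.
apply: derivable_sum => i.
set P : {poly R} := (iter i (@fdiff R) p).[0] *: 'X^i.
set Q : {poly R} := (1 - 'X) ^+ i.+1.
have -> : (fun z : R => (iter i (@fdiff R) p).[0] * (z ^+ i / (1 - z) ^+ i.+1))
    = horner P * (fun z => (horner Q z)^-1).
  apply/funext => z; rewrite fctE /P /Q hornerZ hornerXn horner_exp.
  by rewrite hornerD hornerN hornerX hornerC mulrA.
apply: derivableM; first exact: derivable_horner.
apply: derivableV; last exact: derivable_horner.
rewrite horner_exp hornerD hornerN hornerX hornerC.
by rewrite expf_neq0 // subr_eq0 eq_sym.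
Qed.

Lemma derive1_away1 (R : realType) (f g : R -> R) (x : R) : x != 1 ->
  (forall z, z != 1 -> f z = g z) -> derive1 f x = derive1 g x.
Proof.
move=> x1 h; rewrite !derive1E; apply: near_eq_derive.
have : nbhs x (~` [set 1])%classic.
  by apply: open_nbhs_nbhs; split; [exact/closed_openC/closed_eq|exact/eqP].
by apply: filterS => z /eqP; apply: h.
Qed.

(** Formally, x d/dx multiplies the coefficient of x^g by g. The difference of the two sides
    satisfies the homogeneous functional equation, so [regsum_unique] replaces termwise
    differentiation. *)
Lemma euler_regsum (R : realType) (x : R) (p : {poly R}) : x != 1 ->
  x * derive1 (fun z => regsum z p) x = regsum x ('X * p).
Proof.
move=> x1.
pose S (u : {poly R}) (z : R) := regsum z u.
have dS u : derivable (S u) x 1 by exact: derivable_regsum.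
pose F u := x * 'D_1 (S u) x - regsum x ('X * u).
have FP : scalar F.
  move=> a u v; rewrite /F.
  have -> : S (a *: u + v) = (a \*: S u) + S v.
    by apply/funext => z; rewrite /S (regsumP z).
  rewrite deriveD ?deriveZ //; last exact: derivableZ.
  have -> : 'X * (a *: u + v) = a *: ('X * u) + 'X * v by rewrite mulrDr scalerAr.
  by rewrite (regsumP x) /GRing.scale /=; ring.
pose FL := GRing.isLinear.Build R {poly R} R _ F FP.
pose G : {linear {poly R} -> R | *%R} := HB.pack F FL.
suff : F p = 0 by rewrite derive1E => /eqP; rewrite subr_eq0 => /eqP.
apply: (@regsum_unique _ _ G x1) => {}p; change (F p = x * F (p \Po ('X + 1))).
set p1 := p \Po ('X + 1).
have h1 : 'D_1 (S p) x = S p1 x + x * 'D_1 (S p1) x.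
  rewrite -derive1E (@derive1_away1 _ _ (cst p.[0] + id * S p1)) //; last first.
    by move=> z z1; rewrite fctE /S regsum_shift.
  rewrite derive1E deriveD ?deriveM ?derive_cst ?derive_id //; last exact: derivableM.
  by rewrite add0r addrC /GRing.scale /= mulr1.
have h2 : regsum x ('X * p) = x * (regsum x ('X * p1) + S p1 x).
  rewrite (regsum_shift _ x1) hornerM hornerX mul0r add0r comp_polyM comp_polyX.
  by rewrite mulrDl mul1r linearD.
by rewrite /F h1 h2; ring.
Qed.

Lemma iter_euler_op (R : realType) (k : nat) (x : R) : x != 1 ->
  iter k (@euler_op R) (fun y => y / (1 - y) ^+ 2) x = regsum x 'X^(k.+1).
Proof.
elim: k x => [|k IH] x x1 /=.
  have x1' : 1 - x != 0 by rewrite subr_eq0 eq_sym.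
  have := regsum_shift 'X x1; rewrite hornerX add0r comp_polyX linearD /= regsum1 => h.
  have {}h : (1 - x) * regsum x 'X = x / (1 - x) by rewrite mulrBl mul1r {1}h; ring.
  by apply: (mulfI x1'); rewrite expr1 h; field.
rewrite /euler_op (@derive1_away1 _ _ (fun z => regsum z 'X^(k.+1))) //.
by rewrite euler_regsum // -exprS.
Qed.

Lemma euler_frobenius_regsum (R : realType) (k : nat) (E : {poly R}) (x : R) :
  euler_frobenius k E -> x != 1 ->
  x * E.[x] = (1 - x) ^+ (k + 2) * regsum x 'X^(k.+1).
Proof. by move=> [_ h] x1; rewrite h // iter_euler_op. Qed.

(** Excludes 0 as a root, so that the q_k can be inverted. [A] is the regularized sum of x^(k+1)
    with its pole cleared; at 0 only the first difference, equal to 1, contributes to [A1] = A /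
    x. *)
Lemma euler_frobenius0 (R : realType) (k : nat) (E : {poly R}) :
  euler_frobenius k E -> E.[0] = 1.
Proof.
move=> hE.
pose A : {poly R} := \sum_(i < k.+2)
  (iter i (@fdiff R) 'X^(k.+1)).[0] *: ('X^i * (1 - 'X) ^+ (k.+1 - i)).
pose A1 : {poly R} := \sum_(i < k.+1)
  (iter i.+1 (@fdiff R) 'X^(k.+1)).[0] *: ('X^i * (1 - 'X) ^+ (k - i)).
have A0 : A = 'X * A1.
  rewrite /A big_ord_recl /= hornerXn expr0n scale0r add0r mulr_sumr.
  apply: eq_bigr => i _; rewrite /bump /= ?add1n subSS exprS -scalerAr.
  by rewrite mulrA -(exprS 'X i).
have -> : E = A1.
  apply/eqP; rewrite -subr_eq0; apply/eqP.
  apply: (@poly0_cofinite _ _ [:: 0; 1]) => x; rewrite !inE negb_or => /andP[x0 x1].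
  apply/eqP; rewrite hornerD hornerN subr_eq0; apply/eqP.
  apply: (mulfI x0); rewrite (euler_frobenius_regsum hE) //.
  transitivity A.[x]; last by rewrite A0 hornerM hornerX.
  rewrite (@regsumE _ _ _ k.+2) ?size_polyXn // mulr_sumr /A horner_sum.
  apply: eq_bigr => i _; rewrite hornerZ hornerM hornerXn horner_exp.
  rewrite hornerD hornerN hornerX hornerC.
  have x1' : 1 - x != 0 by rewrite subr_eq0 eq_sym.
  have -> : (k + 2 = (k.+1 - i) + i.+1)%N by have := ltn_ord i; lia.
  by rewrite exprD; field; rewrite expf_neq0.
rewrite /A1 horner_sum big_ord_recl big1 ?addr0 => [|i _]; last first.
  by rewrite hornerZ hornerM hornerXn expr0n /= mul0r mulr0.
have h : (1 - 'X).[0] = 1 :> R by rewrite !hornerE subr0.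
rewrite hornerZ hornerM hornerXn horner_exp h /= !expr1n !mulr1 /fdiff.
by rewrite hornerD hornerN horner_comp !hornerE expr1n expr0n subr0.
Qed.

(** * Sobolev's system *)

Lemma exists_root_seq (R : realType) (p : {poly R}) : p != 0 ->
  exists s : seq R, forall z, root p z -> z \in s.
Proof.
have [n] := ubnP (size p); elim: n p => // n IH p; rewrite ltnS => hp p0.
have [[a pa]|nr] := pselect (exists a, root p a); last first.
  by exists [::] => z pz; case: nr; exists z.
have [r er] := factor_theorem p a pa.
have r0 : r != 0 by apply: contraNneq p0 => e; rewrite er e mul0r.
have [|s hs] := IH r _ r0.
  by rewrite (leq_trans _ hp) // er size_Mmonic ?monicXsubC // size_XsubC addn2.
exists (a :: s) => z; rewrite er rootM root_XsubC inE => /orP[/hs ->|->] //.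
by rewrite orbT.
Qed.

Lemma node_rev (R : realType) (N b : nat) : (0 < N)%N -> (b <= N)%N ->
  node R N (N - b) = 1 - node R N b.
Proof.
move=> N0 hb; rewrite /node natrB // mulrBr mulVf // pnatr_eq0.
by case: N N0 {hb}.
Qed.

(** The integral over [0, 1] taken coefficientwise, which keeps the treatment of the system purely
    algebraic. *)
Definition poly_int (R : realType) (p : {poly R}) : R :=
  \sum_(i < size p) p`_i / i.+1%:R.

Lemma poly_intE (R : realType) (p : {poly R}) (D : nat) : (size p <= D)%N ->
  poly_int p = \sum_(i < D) p`_i / i.+1%:R.
Proof.
move=> hD; rewrite /poly_int (big_ord_widen _ (fun i : nat => p`_i / i.+1%:R) hD).
rewrite big_mkcond /=; apply: eq_bigr => i _; case: ltnP => // hi.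
by rewrite nth_default // mul0r.
Qed.

Lemma poly_int_deriv (R : realType) (p : {poly R}) : poly_int p^`() = p.[1] - p.[0].
Proof.
rewrite (@poly_intE _ _ (size p)); last first.
  by rewrite (leq_trans (size_poly _ _)) // leq_pred.
rewrite (@horner_coef_wide _ (size p).+1) // horner_coef0 big_ord_recl.
rewrite expr0 mulr1 addrAC subrr add0r; apply: eq_bigr => i _.
by rewrite coef_deriv expr1n mulr1 -[p`_ _ *+ _]mulr_natr mulfK //.
Qed.

Lemma exact_poly (R : realType) (m N : nat) (C : 'rV[R]_N.+1) (p : {poly R}) :
  (forall a : 'I_m, \sum_(c < N.+1) C 0 c * node R N c ^+ a = (a.+1)%:R^-1) ->
  (size p <= m)%N ->
  \sum_(c < N.+1) C 0 c * p.[node R N c] = poly_int p.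
Proof.
move=> hC hp; rewrite (poly_intE hp).
under eq_bigr => c _ do rewrite (horner_coef_wide _ hp) mulr_sumr.
rewrite exchange_big; apply: eq_bigr => a _; rewrite -hC mulr_sumr.
by apply: eq_bigr => c _; rewrite mulrCA.
Qed.

(* The difference on the right is [\int_0^1 (y - x) ^ (2m-1) / (2m-1)! dy], of
   which an exact rule reproduces the terms of degree >= m in x. *)
Lemma exact_power_kernel (R : realType) (m N : nat) (C : 'rV[R]_N.+1) :
  (0 < m)%N ->
  (forall a : 'I_m, \sum_(c < N.+1) C 0 c * node R N c ^+ a = (a.+1)%:R^-1) ->
  exists2 Q : {poly R}, (size Q <= m)%N &
    \sum_(c < N.+1) C 0 c *: (divpow R (2 * m - 1) \Po ((node R N c)%:P - 'X))
    = (divpow R (2 * m) \Po (1 - 'X)) - divpow R (2 * m) + Q.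
Proof.
move=> m0 hC; set n := (2 * m - 1)%N.
set V := \sum_(c < N.+1) _; set F := _ - divpow R (2 * m).
exists (V - F); last by rewrite addrC subrK.
have coefB_exp (a : R) k i : (divpow R k \Po (a%:P - 'X))`_i
    = if (i <= k)%N then (-1) ^+ i * a ^+ (k - i) / (i`! * (k - i)`!)%:R else 0.
  rewrite comp_polyZ comp_Xn_poly coefZ exprBn coef_sum.
  have eC j : (-1) ^+ j * a%:P ^+ (k - j) = ((-1) ^+ j * a ^+ (k - j))%:P.
    by rewrite polyCM !polyC_exp polyCN polyC1.
  under eq_bigr => j _ do rewrite coefMn eC coefCM coefXn.
  have fn0 := @fact_neq0 R; case: leqP => hi; last first.
    rewrite big1 ?mulr0 // => j _; case: eqP => [e|_]; last by rewrite !mulr0 mul0rn.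
    by have := ltn_ord j; lia.
  rewrite (bigD1 (Ordinal (hi : (i < k.+1)%N))) //= eqxx mulr1 big1 ?addr0.
    rewrite -(bin_fact hi) !natrM -mulr_natr.
    have h4 : 'C(k, i)%:R != 0 :> R by rewrite pnatr_eq0 -lt0n bin_gt0.
    by field; rewrite !fn0 h4.
  move=> j; rewrite -val_eqE /=; case: eqP => // hij _.
  by case: eqP => [e|_]; [rewrite e in hij|rewrite !mulr0 mul0rn].
apply/leq_sizeP => i hi; rewrite coefB; apply/eqP; rewrite subr_eq0; apply/eqP.
rewrite /F coefB -[1]/(1%:P) coefB_exp expr1n mulr1 [X in _ - X]coefZ coefXn.
rewrite coef_sum; under eq_bigr => c _ do rewrite coefZ coefB_exp.
(* For i < 2m, the bound m <= i gives n - i < m, where exactness applies. At i = 2m the two powers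
   cancel by parity, and beyond it all coefficients vanish. *)
have [hin|hin|ein] := ltngtP i (2 * m)%N.
- have -> : (i <= n)%N by rewrite /n; lia.
  rewrite mulr0 subr0.
  have hni : (n - i < m)%N by rewrite /n; lia.
  have := hC (Ordinal hni) => /= hCi.
  transitivity ((-1) ^+ i / (i`! * (n - i)`!)%:R * (n - i).+1%:R^-1 : R).
    rewrite -hCi mulr_sumr; apply: eq_bigr => c _; ring.
  have -> : (2 * m - i = (n - i).+1)%N by rewrite /n; lia.
  rewrite factS !natrM; have fn0 := @fact_neq0 R.
  by field; rewrite !fn0 nat1r pnatr_eq0.
- have -> : (i <= n)%N = false by rewrite /n; lia.
  by rewrite mulr0 subr0 big1 // => c _; rewrite mulr0.
rewrite ein /n (_ : (2 * m <= 2 * m - 1)%N = false); last by lia.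
rewrite big1 => [|c _]; last by rewrite mulr0.
by rewrite mulr1 subnn fact0 muln1 exprM sqrrN !expr1n div1r subrr.
Qed.

(** For odd n the truncated power of y is (|y|^n + y^n) / 2. The sum of the pure powers is known
    from [exact_power_kernel]; it turns the symmetric right side of the system into (1 - x)^(2m) /
    (2m)!, up to degree < m. *)
Lemma sobolev_system_truncated (R : realType) (m N : nat) (C : 'rV[R]_N.+1)
    (lam : 'rV[R]_m) : (0 < m)%N -> (0 < N)%N -> sobolev_system C lam ->
  exists2 P : {poly R}, (size P <= m)%N &
  forall b : nat, (b <= N)%N ->
    \sum_(c < N.+1) C 0 c * (if (b < c)%N
        then (node R N c - node R N b) ^+ (2 * m - 1) / (2 * m - 1)`!%:R else 0)
    = (1 - node R N b) ^+ (2 * m) / (2 * m)`!%:R - P.[node R N b].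
Proof.
move=> m0 N0 [hs hC]; have [Q hQ eQ] := exact_power_kernel m0 hC.
set n := (2 * m - 1)%N in hs eQ *.
have on : odd n by rewrite /n; case: (m) m0 => // k _; rewrite mulnS; lia.
pose L := \sum_(a < m) lam 0 a *: 'X^a.
have hL : (size L <= m)%N.
  rewrite (leq_trans (size_sum _ _ _)) //; apply/bigmax_leqP => a _.
  by rewrite (leq_trans (size_scale_leq _ _)) // size_polyXn.
exists (L - 2^-1 *: Q).
  rewrite (leq_trans (size_polyD _ _)) // geq_max hL size_polyN.
  exact: leq_trans (size_scale_leq _ _) hQ.
move=> b hb; have := hs (Ordinal (hb : (b < N.+1)%N)) => /=.
have -> : \sum_(a < m) lam 0 a * node R N b ^+ a = L.[node R N b].
  by rewrite /L horner_sum; apply: eq_bigr => a _; rewrite hornerZ hornerXn.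
have := congr1 (horner^~ (node R N b)) eQ.
have eX (a y : R) : (a%:P - 'X).[y] = a - y by rewrite hornerD hornerN hornerX hornerC.
rewrite 2!hornerD hornerN horner_comp !horner_divpow eX horner_sum.
set x := node R N b.
rewrite (eq_bigr (fun c => C 0 c * ((node R N c - x) ^+ n / n`!%:R))); last first.
  by move=> c _; rewrite hornerZ horner_comp eX horner_divpow.
move=> h1 h2; rewrite hornerD hornerN (hornerZ 2^-1).
have key c : C 0 c * (if (b < c)%N then (node R N c - x) ^+ n / n`!%:R else 0)
   = C 0 c * (`|x - node R N c| ^+ n / (2 * n`!%:R))
     + 2^-1 * (C 0 c * ((node R N c - x) ^+ n / n`!%:R)).
  have f0 := fact_neq0 R n.
  have N0' : 0 < N%:R^-1 :> R by rewrite invr_gt0 ltr0n.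
  case: ltnP => hbc.
    have le : x < node R N c by rewrite /x /node ltr_pM2l // ltr_nat.
    by rewrite distrC gtr0_norm ?subr_gt0 //; field.
  have le : node R N c <= x by rewrite /x /node ler_pM2l // ler_nat.
  rewrite ger0_norm ?subr_ge0 // -opprB exprNn -signr_odd on expr1.
  by field.
under eq_bigr => c _ do rewrite key.
rewrite big_split /= -mulr_sumr h1.
by move: h2 => /(canRL (addrK _)) ->; lra.
Qed.

Lemma poly_int_1subX (R : realType) (a : nat) :
  poly_int ((1 - 'X) ^+ a) = a.+1%:R^-1 :> R.
Proof.
have -> : (1 - 'X) ^+ a = (- (a.+1%:R^-1) *: (1 - 'X) ^+ a.+1)^`() :> {poly R}.
  rewrite derivZ deriv_exp derivB derivX -polyC1 derivC sub0r polyC1 /= mulN1r.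
  rewrite mulNrn scalerN scaleNr opprK -scalerMnr scalerMnl -mulr_natr.
  by rewrite mulVf ?scale1r // pnatr_eq0.
rewrite poly_int_deriv !hornerZ !horner_exp !hornerD !hornerN !hornerX !hornerC.
by rewrite subrr subr0 expr1n expr0n /= mulr0 sub0r mulr1 opprK.
Qed.

(** The system is invariant under x -> 1 - x, the multipliers being those of the reflected
    polynomial; with uniqueness this gives the symmetry of the rule. *)
Lemma sobolev_system_rev (R : realType) (m N : nat) (C : 'rV[R]_N.+1)
    (lam : 'rV[R]_m) : (0 < N)%N -> sobolev_system C lam ->
  exists lam', sobolev_system (\row_c C 0 (rev_ord c)) (lam' : 'rV[R]_m).
Proof.
move=> N0 [hs hC].
have nodeE (c : 'I_N.+1) : node R N (rev_ord c) = 1 - node R N c.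
  by rewrite /= subSS node_rev // -ltnS.
pose L := \sum_(a < m) lam 0 a *: 'X^a.
have LE x : L.[x] = \sum_(a < m) lam 0 a * x ^+ a.
  by rewrite /L horner_sum; apply: eq_bigr => a _; rewrite hornerZ hornerXn.
have hL : (size L <= m)%N.
  rewrite (leq_trans (size_sum _ _ _)) //; apply/bigmax_leqP => a _.
  by rewrite (leq_trans (size_scale_leq _ _)) // size_polyXn.
have s2 : size (1 - 'X : {poly R}) = 2%N.
  by rewrite -(opprK (1 - 'X)) opprB size_polyN -polyC1 size_XsubC.
have hL' : (size (L \Po (1 - 'X)) <= m)%N by rewrite size_comp_poly2.
exists (\row_a (L \Po (1 - 'X))`_a); split.
  move=> b; have := hs (rev_ord b); rewrite nodeE.
  rewrite (reindex_inj rev_ord_inj) /= -LE => e.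
  have -> : \sum_(a < m) (\row_a0 (L \Po (1 - 'X))`_a0) 0 a * node R N b ^+ a
      = L.[1 - node R N b].
    transitivity (L \Po (1 - 'X)).[node R N b].
      by rewrite (horner_coef_wide _ hL'); apply: eq_bigr => a _; rewrite mxE.
    by rewrite horner_comp hornerD hornerN hornerX hornerC.
  rewrite addrC in e; rewrite addrC [in RHS]addrC.
  move: e; rewrite subKr => <-; congr (_ + _); apply: eq_bigr => c _.
  rewrite mxE nodeE; congr (_ * (_ / _)); congr (_ ^+ _).
  by rewrite distrC; congr `|_|; ring.
move=> a; rewrite -poly_int_1subX -(@exact_poly _ m N C) //; last first.
  by rewrite -(opprK (1 - 'X)) opprB exprNn -signr_odd size_Msign -polyC1 size_exp_XsubC.
rewrite (reindex_inj rev_ord_inj) /=; apply: eq_bigr => c _.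
rewrite mxE rev_ordK horner_exp hornerD hornerN hornerX hornerC -nodeE.
by [].
Qed.

(** After scaling the nodes to integers, [genfun_identity] yields polynomials R1 at z and R2 at 1/z.
    Using it at 1/z as well, symmetry of the rule exchanges the two, and the average serves as u. *)
Lemma lattice_genfun (R : realType) (m N : nat) (C : 'rV[R]_N.+1)
    (lam : 'rV[R]_m) : (0 < m)%N -> (0 < N)%N -> sobolev_system C lam ->
  (forall c, C 0 (rev_ord c) = C 0 c) ->
  exists u : {poly R},
  [/\ (size u <= (2 * m).+1)%N, u.[0] = 0, u`_(2 * m) = (2 * m)`!%:R^-1,
      forall i, (m <= i < 2 * m)%N -> u`_i = 0
    & forall z, z != 0 -> z != 1 ->
       (\sum_(g < N.+1) N%:R * C 0 (inord g) * z ^+ g) * regsum z (divpow R (2 * m - 1))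
       = regsum z u + z ^+ N * regsum z^-1 u].
Proof.
move=> m0 N0 hs sym; have [P hP eP] := sobolev_system_truncated m0 N0 hs.
have [Q hQ eQ] := exact_power_kernel m0 hs.2.
have N0' : N%:R != 0 :> R by rewrite pnatr_eq0 -lt0n.
set n := (2 * m - 1)%N in eP eQ *.
have en : (2 * m = n.+1)%N by rewrite /n; lia.
have on : odd n by rewrite /n; case: (m) m0 => // k _; rewrite mulnS; lia.
have n0 : (0 < n)%N by case: (n) on.
pose c (g : nat) : R := N%:R * C 0 (inord g).
(* The factor N^(n+1) combines N^n from the kernel of degree n with the N contained in [c]. *)
pose T (p : {poly R}) := N%:R ^+ n.+1 *: (p \Po (N%:R^-1 *: 'X)).
have TE p x : (T p).[x] = N%:R ^+ n.+1 * p.[N%:R^-1 * x].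
  by rewrite hornerZ horner_comp hornerZ hornerX.
have sT (p : {poly R}) : (size p <= m)%N -> (size (T p) <= m)%N.
  move=> hp; apply: leq_trans (size_scale_leq _ _) _.
  by rewrite size_comp_poly2 // size_scale ?size_polyX // invr_eq0.
have eX (a y : R) : (a%:P - 'X).[y] = a - y by rewrite hornerD hornerN hornerX hornerC.
have sX (a : R) : size (a%:P - 'X : {poly R}) = 2%N by rewrite -opprB size_polyN size_XsubC.
pose D := divpow R n.+1.
pose W := (D \Po (N%:R%:P - 'X)) - T P.
pose V := \sum_(g < N.+1) c g *: (divpow R n \Po (g%:R%:P - 'X)).
have VE : V = (D \Po (N%:R%:P - 'X)) - D + T Q.
  apply: poly_ext => x.
  have e : \sum_(g < N.+1) C 0 g * ((node R N g - N%:R^-1 * x) ^+ n / n`!%:R)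
      = (1 - N%:R^-1 * x) ^+ n.+1 / n.+1`!%:R - (N%:R^-1 * x) ^+ n.+1 / n.+1`!%:R
        + Q.[N%:R^-1 * x].
    have := congr1 (horner^~ (N%:R^-1 * x)) eQ.
    rewrite en 2!hornerD hornerN horner_comp !horner_divpow -polyC1 eX => <-.
    rewrite horner_sum; apply: eq_bigr => g _.
    by rewrite hornerZ horner_comp eX horner_divpow.
  have -> : V.[x] = N%:R ^+ n.+1
      * \sum_(g < N.+1) C 0 g * ((node R N g - N%:R^-1 * x) ^+ n / n`!%:R).
    rewrite /V horner_sum mulr_sumr; apply: eq_bigr => g _.
    rewrite hornerZ horner_comp eX horner_divpow.
    rewrite /c inord_val /node -mulrBr exprMn exprVn exprS.
    by field; rewrite ?fact_neq0 ?expf_neq0 ?N0'.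
  rewrite e 2!hornerD hornerN horner_comp !horner_divpow eX TE.
  rewrite !mulrDr mulrN !mulrA -!exprMn mulrBr mulr1 mulVKf //.
have WE b : (b <= N)%N -> \sum_(g < N.+1) c g * (if (b < g)%N
    then (g%:R - b%:R) ^+ n / n`!%:R else 0) = W.[b%:R].
  move=> hb; rewrite /W hornerD hornerN horner_comp eX horner_divpow TE.
  rewrite -/(node R N b) -[P.[_]](subKr ((1 - node R N b) ^+ (2 * m) / (2 * m)`!%:R)) -eP //.
  rewrite mulrBr opprB en [N%:R ^+ _ * (_ / _)]mulrA -exprMn mulrBr mulr1 mulVKf //.
  rewrite addrC subrK mulr_sumr.
  apply: eq_bigr => g _; rewrite /c inord_val; case: ifP => _; last by rewrite !mulr0.
  rewrite /node -mulrBr exprMn exprVn exprS.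
  by field; rewrite ?fact_neq0 ?expf_neq0 ?N0'.
pose R1 := W - V; pose R2 := W \Po (N%:R%:P - 'X).
pose S := 2^-1 *: (- (T P + T Q) - (T P \Po (N%:R%:P - 'X))).
have uE : 2^-1 *: (R1 + R2) = D + S.
  apply: poly_ext => x; rewrite /R1 /R2 /S /W VE.
  rewrite !(hornerZ 2^-1, hornerD, hornerN, horner_comp, eX, horner_divpow).
  by rewrite !hornerC !hornerX subKr; field; rewrite fact_neq0.
have hS : (size S <= m)%N.
  apply: leq_trans (size_scale_leq _ _) _.
  rewrite (leq_trans (size_polyD _ _)) // geq_max !size_polyN size_comp_poly2 ?sX // sT // andbT.
  by rewrite (leq_trans (size_polyD _ _)) // geq_max !sT.
have coefu i : (m <= i)%N -> (D + S)`_i = (i == n.+1)%:R / n.+1`!%:R.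
  move=> hi; rewrite coefD [S`_i]nth_default ?(leq_trans hS) // addr0 coefZ coefXn.
  by rewrite mulrC.
exists (D + S); split.
- rewrite (leq_trans (size_polyD _ _)) // geq_max en size_divpow /=.
  by rewrite (leq_trans hS) // -en; lia.
(* Stationarity at the two end nodes: it gives W(0) = V(0), and W(N) = 0 as no node lies beyond
   N. *)
- rewrite -uE hornerZ hornerD /R1 /R2 horner_comp eX subr0 hornerD hornerN.
  rewrite -[0]/(0%:R) -WE // -WE // [X in _ + X]big1 => [|g _]; last first.
    by rewrite ltnNge -ltnS ltn_ord /= mulr0.
  rewrite addr0 /V horner_sum -sumrB big1 ?mulr0 // => g _.
  rewrite hornerZ horner_comp eX horner_divpow -mulrBr.
  case: ifP => [_|]; first by rewrite subrr mulr0.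
  by move/negbT; rewrite -eqn0Ngt => /eqP ->; rewrite subrr expr0n gtn_eqF // mul0r subrr mulr0.
- by rewrite coefu ?en ?eqxx ?div1r //; lia.
- by move=> i /andP[hi hi2]; rewrite coefu // ltn_eqF ?mul0r // -en.
have ruE z : regsum z (D + S) = 2^-1 * (regsum z R1 + regsum z R2).
  by rewrite -uE regsumZ linearD.
move=> z z0 z1; rewrite !ruE.
have zV0 : z^-1 != 0 by rewrite invr_eq0.
have zV1 : z^-1 != 1 by rewrite invr_eq1.
have h1 := genfun_identity on z0 z1 WE.
have h2 := genfun_identity on zV0 zV1 WE.
rewrite -/V -/R1 -/R2 in h1; rewrite -/V -/R1 -/R2 invrK in h2.
have h3 : \sum_(g < N.+1) c g * z ^+ g = z ^+ N * \sum_(g < N.+1) c g * z^-1 ^+ g.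
  rewrite (reindex_inj rev_ord_inj) mulr_sumr; apply: eq_bigr => g _.
  rewrite /c !inord_val sym /= subSS mulrCA; congr (_ * _).
  have hg : (g <= N)%N by rewrite -ltnS.
  have -> : z ^+ N = z ^+ (N - g) * z ^+ g by rewrite -exprD subnK.
  by rewrite exprVn mulfK // expf_neq0.
have h4 : regsum z^-1 (divpow R n) = regsum z (divpow R n).
  by rewrite !regsumZ regsumXn_inv.
rewrite h4 in h2.
have : z ^+ N * ((\sum_(g < N.+1) c g * z^-1 ^+ g) * regsum z (divpow R n)) =
  (\sum_(g < N.+1) c g * z ^+ g) * regsum z (divpow R n) by rewrite h3 mulrA.
rewrite h2 h1 mulrDr mulrA exprVn mulfV ?expf_neq0 // mul1r => h5.
by lra.
Qed.

Lemma regsumXn_diff0 (R : realType) (z : R) (j : nat) : (0 < j)%N ->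
  regsum z 'X^j = \sum_(1 <= i < j.+1) diff0 R i j * (z ^+ i / (1 - z) ^+ i.+1).
Proof.
move=> j0; have d0 i : (iter i (@fdiff R) 'X^j).[0] = diff0 R i j.
  by rewrite iter_fdiff_horner; apply: eq_bigr => a _; rewrite add0r hornerXn.
rewrite /regsum size_polyXn -(big_mkord xpredT (fun i =>
  (iter i (@fdiff R) 'X^j).[0] * (z ^+ i / (1 - z) ^+ i.+1))) big_ltn //.
rewrite /= hornerXn expr0n gtn_eqF // mul0r add0r.
by apply: eq_bigr => i _; rewrite d0.
Qed.

(** Over the denominator (q - 1)^(i+1) the sum at 1/q contributes q and the sum at q contributes the
    signed power q^(N+i). *)
Lemma regsum_pair_diff0 (R : realType) (q : R) (N j : nat) :
  q != 0 -> q != 1 -> (0 < j)%N ->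
  regsum q^-1 'X^j + q ^+ N * regsum q 'X^j
  = \sum_(1 <= i < j.+1)
      (q + (-1) ^+ i.+1 * q ^+ (N + i)) / (q - 1) ^+ i.+1 * diff0 R i j.
Proof.
move=> q0 q1 j0; rewrite !regsumXn_diff0 // mulr_sumr -big_split /=.
have q1' : q - 1 != 0 by rewrite subr_eq0.
apply: eq_bigr => i _.
have -> : 1 - q^-1 = (q - 1) / q by field.
have -> : 1 - q = - 1 * (q - 1) by ring.
have hs : ((- 1) ^+ i.+1)^-1 = (- 1) ^+ i.+1 :> R by rewrite -exprVn invrN1.
rewrite !exprMn !exprVn exprD [((-1) ^+ _ * _)^-1]invfM hs.
rewrite [q ^+ i.+1]exprS; move: ((- 1) ^+ i.+1) => s; field.
by rewrite ?expf_neq0 // q0.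
Qed.

Lemma sobolev_solution_form (R : realType) (m N : nat) (E : {poly R})
    (q : 'I_m.-1 -> R) (C : 'rV[R]_N.+1) (lam : 'rV[R]_m) :
  (1 <= m)%N -> (1 <= N)%N ->
  euler_frobenius (2 * m - 2) E -> inner_roots E q ->
  sobolev_system_uniquely_solvable R m N -> sobolev_system C lam ->
  exists d : 'I_m.-1 -> R,
  [/\ forall j : nat, (1 <= j <= m.-1)%N ->
        \sum_(k < m.-1) d k *
         (\sum_(1 <= i < j.+1)
            (q k + (-1) ^+ i.+1 * q k ^+ (N + i)) / (q k - 1) ^+ i.+1
            * diff0 R i j)
        = bernoulli R j.+1 / j.+1%:R,
      forall b : 'I_N.+1, (b == 0%N :> nat) || (b == N :> nat) ->
        C 0 b = N%:R^-1 * (2^-1 - \sum_k d k * ((q k - q k ^+ N) / (1 - q k)))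
    & forall b : 'I_N.+1, (0 < b < N)%N ->
        C 0 b = N%:R^-1 * (1 + \sum_k d k * (q k ^+ b + q k ^+ (N - b)))].
Proof.
move=> m0 N0 hE [q_inj hq] [[C0 lam0] /= [_ huniq]] hs.
(* The reversed rule solves the system too, so uniqueness makes the rule symmetric. *)
have sym c : C 0 (rev_ord c) = C 0 c.
  have [lam' hs'] := sobolev_system_rev N0 hs.
  have [e1 _] := huniq (C, lam) hs; have [e2 _] := huniq (_, lam') hs'.
  by have := congr1 (fun M : 'rV[R]_N.+1 => M 0 c) (etrans (esym e2) e1); rewrite mxE.
have [u [hu u0 ulead umid gen]] := lattice_genfun m0 N0 hs sym.
have en : (2 * m - 1 = (2 * m - 2).+1)%N by lia.
have regE x : x != 1 -> x * E.[x] = (1 - x) ^+ (2 * m) * regsum x 'X^(2 * m - 1).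
  move=> x1; rewrite (euler_frobenius_regsum hE x1) -en.
  by rewrite (_ : 2 * m - 2 + 2 = 2 * m)%N //; lia.
have E0 := euler_frobenius0 hE.
have rootq k : root E (q k) /\ `|q k| < 1 by apply/hq; exists k.
have q0 k : q k != 0.
  apply/eqP => e; have [/rootP] := rootq k; rewrite e E0 => /eqP.
  by rewrite oner_eq0.
have q1 k : q k != 1.
  by apply/eqP => e; have [_] := rootq k; rewrite e normr1 ltxx.
have regq k : regsum (q k) 'X^(2 * m - 1) = 0.
  have := regE _ (q1 k); have [/rootP -> _] := rootq k; rewrite mulr0 => /esym/eqP.
  by rewrite mulf_eq0 expf_eq0 subr_eq0 eq_sym (negPf (q1 k)) andbF /= => /eqP.
have Enz : E != 0 by apply: contraTneq (oner_neq0 R) => e; rewrite -E0 e horner0 eqxx.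
have [s hsroot] := exists_root_seq Enz.
have hbad z : z \notin [:: 0, 1 & s] -> regsum z 'X^(2 * m - 1) != 0.
  rewrite !inE !negb_or => /and3P[z0 z1 zs]; apply/eqP => e.
  have := regE z z1; rewrite e mulr0 => /eqP; rewrite mulf_eq0 (negPf z0) /=.
  by move=> /hsroot; rewrite (negPf zs).
have N0' : N%:R != 0 :> R by rewrite pnatr_eq0 -lt0n.
have [d [h1 h2 h3]] := @coefs_of_genfun R m N q
  (fun g => N%:R * C 0 (inord g)) u _ m0 N0 q_inj q0 (fun k => (rootq k).2) regq
  hbad hu u0 ulead umid gen.
have CE (b : 'I_N.+1) x : N%:R * C 0 (inord b) = x -> C 0 b = N%:R^-1 * x.
  by rewrite inord_val => <-; rewrite mulKf.
exists d; split=> [j /andP[j1 jm]|b hb|b hb]; last 2 first.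
- by apply: CE; exact: h2.
- by apply: CE; exact: h3.
rewrite -h1 ?j1 //; apply: eq_bigr => k _.
by rewrite regsum_pair_diff0.
Qed.

Local Notation mu := (@lebesgue_measure _).
Local Notation I01 := (`[0, 1]%classic).

(** * Peano kernels *)

(** Fubini on the triangle 0 <= t <= s <= 1. *)
Lemma Rintegral_swap_triangle (R : realType) (w v : R -> R) (M : R) :
  measurable_fun (I01 : set R) w ->
  (forall x, 0 <= x <= 1 -> `|w x| <= M) ->
  mu.-integrable (I01 : set R) (EFin \o v) ->
  \int[mu]_(s in I01) (w s * \int[mu]_(t in `[0, s]) v t)
  = \int[mu]_(t in I01) (v t * \int[mu]_(s in `[t, 1]) w s).
Proof.
move=> mw bw iv.
have mI : measurable (I01 : set R) by exact: measurable_itv.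
pose a : R -> R := w \_ I01.
pose b : R -> R := v \_ I01.
have ma : measurable_fun setT a by apply/(measurable_restrictT _ mI).
have ib : mu.-integrable setT (EFin \o b).
  by rewrite -restrict_EFin; apply: (integrable_mkcond _ _).1.
have mb : measurable_fun setT b by apply/measurable_EFinP; exact: measurable_int ib.
have iw : mu.-integrable (I01 : set R) (EFin \o w).
  apply: measurable_bounded_integrable => //.
    by rewrite /= lebesgue_measure_itv /= lte_fin ltr01 -EFinB ltry.
  exists M; split; first exact: num_real.
  move=> x Mx z; rewrite /= in_itv /= => hz.
  exact: le_trans (bw _ hz) (ltW Mx).
have memI s : (s \in (I01 : set R)) = (0 <= s <= 1) by rewrite mem_setE in_itv /=.
have aE s : 0 <= s <= 1 -> a s = w s by move=> hs; rewrite /a patchE memI hs.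
have aN s : ~~ (0 <= s <= 1) -> a s = 0 by move=> hs; rewrite /a patchE memI (negPf hs).
have bE s : 0 <= s <= 1 -> b s = v s by move=> hs; rewrite /b patchE memI hs.
have bN s : ~~ (0 <= s <= 1) -> b s = 0 by move=> hs; rewrite /b patchE memI (negPf hs).
have M0 : 0 <= M by apply: le_trans (bw 0 _); rewrite ?normr_ge0 // lexx ler01.
have ba s : `|a s| <= M.
  by case: (boolP (0 <= s <= 1)) => hs; [rewrite aE // bw|rewrite aN // normr0].
(* The integrand is h g with h bounded, carrying the indicator of the triangle, and g integrable on
   the plane. *)
pose h (z : R * R) : R := a z.1 * (if z.2 <= z.1 then 1 else 0).
pose g (z : R * R) : R := (\1_(I01 : set R) z.1) * b z.2.
have mh : measurable_fun setT h.
  apply: measurable_funM; first exact: measurableT_comp.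
  apply: measurable_fun_ifT => //.
  by apply: measurable_fun_ler; [exact: measurable_snd|exact: measurable_fst].
have mg : measurable_fun setT g.
  apply: measurable_funM.
    by apply: measurableT_comp => //; exact: measurable_indic.
  by apply: measurableT_comp.
have ig : (mu \x mu)%E.-integrable setT (EFin \o g).
  apply/integrable12ltyP; first exact/measurable_EFinP.
  have -> : (fun x => \int[mu]_y `|(EFin \o g) (x, y)|)%E
      = (fun x => (\1_(I01 : set R) x)%:E * \int[mu]_y `|(b y)%:E|)%E.
    apply/funext => x; rewrite -ge0_integralZl //.
    - by apply: eq_integral => y _; rewrite /g /= normrM ger0_norm // EFinM.
    - by apply: measurableT_comp => //; exact/measurable_EFinP.
  rewrite ge0_integralZr //.
  - rewrite integral_indic //= setIT lebesgue_measure_itv /= lte_fin ltr01 EFinN sube0 mul1e.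
    by have /integrableP[] := ib.
  - by apply/measurable_EFinP; exact: measurable_indic.
  - by apply: integral_ge0 => *; exact: abse_ge0.
pose f (z : R * R) : \bar R := (h z * b z.2)%:E.
have if_ : (mu \x mu)%E.-integrable setT f.
  have -> : f = ((EFin \o h) \* (EFin \o g))%E.
    apply/funext => -[s t]; rewrite /f /g /h /= -EFinM; congr EFin.
    rewrite indicE memI; case: (boolP (0 <= s <= 1)) => hs; first by rewrite mul1r.
    by rewrite aN // !mul0r.
  apply: integrableMr => //.
  exists M; split; first exact: num_real.
  move=> x Mx z _ /=; apply: le_trans (ltW Mx); rewrite /h normrM.
  by case: ifP => _; rewrite ?normr1 ?mulr1 // normr0 mulr0.
have F1 s : 0 <= s <= 1 ->
    (\int[mu]_t f (s, t))%E = (w s * \int[mu]_(t in `[0, s]) v t)%:E.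
  move=> /andP[s0 s1].
  have sub : (`[0, s] `<=` (I01 : set R)) by apply: subset_itvl; rewrite bnd_simp.
  have ivs : mu.-integrable (`[0, s] : set R) (EFin \o v) by exact: integrableS iv.
  rewrite EFinM /Rintegral fineK ?integrable_fin_num // integral_mkcond -integralZl //.
    apply: eq_integral => t _; rewrite patchE mem_setE in_itv /= /f /h /=.
    rewrite aE ?s0 //; case: (boolP (0 <= t <= 1)) => ht.
      rewrite bE //; case/andP: ht => -> _ /=.
      case: ifP => _; first by rewrite mulr1 EFinM.
      by rewrite mulr0 mul0r mule0.
    rewrite bN // mulr0; case: ifP => [/andP[t0 ts]|_]; last by rewrite mule0.
    by rewrite t0 (le_trans ts s1) in ht.
  by apply: (integrable_mkcond _ _).1.
have F2 t : 0 <= t <= 1 ->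
    (\int[mu]_s f (s, t))%E = (v t * \int[mu]_(s in `[t, 1]) w s)%:E.
  move=> /andP[t0 t1].
  have sub : (`[t, 1] `<=` (I01 : set R)) by apply: subset_itvr; rewrite bnd_simp.
  have iws : mu.-integrable (`[t, 1] : set R) (EFin \o w) by exact: integrableS iw.
  rewrite EFinM /Rintegral fineK ?integrable_fin_num // integral_mkcond -integralZl //.
    apply: eq_integral => s _; rewrite patchE mem_setE in_itv /= /f /h /=.
    rewrite bE ?t0 // mulrC EFinM; congr (_ * _)%E.
    case: (boolP (0 <= s <= 1)) => hs.
      rewrite aE //; case/andP: hs => _ -> /=; rewrite andbT.
      by case: ifP => _; rewrite ?mulr1 // mulr0.
    rewrite aN // mul0r; case: ifP => // /andP[ts s1].
    by rewrite (le_trans t0 ts) s1 in hs.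
  by apply: (integrable_mkcond _ _).1.
have := Fubini if_; rewrite /Rintegral => FF; congr fine.
rewrite [LHS]integral_mkcond [RHS]integral_mkcond.
transitivity (\int[mu]_s \int[mu]_t f (s, t))%E.
  apply: eq_integral => s _; rewrite patchE memI; case: (boolP (0 <= s <= 1)) => hs.
    by rewrite F1.
  by rewrite integral0_eq // => t _; rewrite /f /h /= aN // !mul0r.
rewrite FF; apply: eq_integral => t _.
rewrite patchE memI; case: (boolP (0 <= t <= 1)) => ht.
  by rewrite F2.
by rewrite integral0_eq // => s _; rewrite /f /= bN // mulr0.
Qed.

Lemma Rintegral_deriv_poly (R : realType) (p : {poly R}) (a b : R) : a <= b ->
  \int[mu]_(t in `[a, b]) p^`().[t] = p.[b] - p.[a].
Proof.
rewrite le_eqVlt => /predU1P[<-|ab]; first by rewrite set_itv1 Rintegral_set1 subrr.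
have ch (u : {poly R}) x : {for x, continuous (horner u)} by exact: continuous_horner.
rewrite /Rintegral (@continuous_FTC2 _ _ (horner p)) //.
- exact/continuous_subspaceT/continuous_horner.
- split.
  + by move=> x _; exact: derivable_horner.
  + exact/cvg_at_right_filter/ch.
  + exact/cvg_at_left_filter/ch.
- by move=> x _; rewrite derivE.
Qed.

(* The truncated power [(y - t)_+ ^ k / k!], right-continuous in t for k = 0. *)
Definition tpow (R : realType) (k : nat) (y t : R) : R :=
  if t < y then (y - t) ^+ k / k`!%:R else 0.

Lemma tpow_le (R : realType) (k : nat) (y a t : R) : a <= t ->
  `|tpow k y t| <= `|y - a| ^+ k / k`!%:R.
Proof.
move=> at_; rewrite /tpow; case: ltP => ty; last first.
  by rewrite normr0 divr_ge0 // exprn_ge0.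
rewrite normrM normfV normrX ler_pM ?invr_ge0 ?exprn_ge0 //.
  rewrite lerXn2r ?nnegrE // !ger0_norm ?subr_ge0 ?(ltW ty) ?(ltW (le_lt_trans at_ ty)) //.
  by rewrite lerB.
by rewrite ger0_norm.
Qed.

Lemma measurable_tpow (R : realType) (k : nat) (y : R) (D : set R) :
  measurable D -> measurable_fun D (tpow k y).
Proof.
move=> mD; apply: measurable_funS (measurableT) _ _ => //.
apply: measurable_fun_ifT => //; first exact: measurable_fun_ltr.
apply: measurable_funM => //; apply: measurable_funX.
exact: measurable_funB.
Qed.

Lemma integrable_tpow (R : realType) (k : nat) (y a b : R) :
  mu.-integrable (`[a, b] : set R) (EFin \o tpow k y).
Proof.
apply: measurable_bounded_integrable => //.
- rewrite /= lebesgue_measure_itv /=; case: ifP => _; last exact: ltry.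
  by rewrite -EFinB ltry.
- exact: measurable_tpow.
exists (`|y - a| ^+ k / k`!%:R); split; first exact: num_real.
move=> x Mx z; rewrite /= in_itv /= => /andP[az _].
exact: le_trans (tpow_le _ _ az) (ltW Mx).
Qed.

Lemma Rintegral_tpow (R : realType) (k : nat) (y a b : R) : a <= b ->
  \int[mu]_(t in `[a, b]) tpow k y t = tpow k.+1 y a - tpow k.+1 y b.
Proof.
move=> ab.
have case1 c : a <= c -> c <= y ->
    \int[mu]_(t in `[a, c]) tpow k y t = tpow k.+1 y a - tpow k.+1 y c.
  move=> ac cy; pose p : {poly R} := - (k.+1`!%:R^-1) *: (y%:P - 'X) ^+ k.+1.
  have pE x : x <= y -> p.[x] = - tpow k.+1 y x.
    rewrite /p /tpow le_eqVlt hornerZ horner_exp hornerD hornerN hornerX hornerC => /predU1P[->|->].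
      by rewrite subrr expr0n /= mulr0 ltxx oppr0.
    by rewrite mulNr mulrC.
  transitivity (\int[mu]_(t in `[a, c]) p^`().[t]); last first.
    by rewrite Rintegral_deriv_poly // !pE ?(le_trans ac) // opprK addrC.
  have sub : `[a, c[ `<=` (`[a, c] : set R) by apply: subset_itvl; rewrite bnd_simp.
  (* If c = y and k = 0, [tpow] and the derivative of p disagree at the right end, which is
     therefore removed. *)
  rewrite -Rintegral_itv_bndo_bndc; last first.
    by apply: integrableS (integrable_tpow k y a c).
  rewrite -Rintegral_itv_bndo_bndc; last first.
    have ip : mu.-integrable (`[a, c] : set R) (EFin \o horner p^`()).
      apply: continuous_compact_integrable; first exact: segment_compact.
      exact/continuous_subspaceT/continuous_horner.
    by apply: integrableS ip.
  apply: eq_Rintegral => t; rewrite mem_setE in_itv /= => /andP[_ tc].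
  rewrite /tpow (lt_le_trans tc cy) /p derivZ deriv_exp derivB derivX derivC sub0r.
  rewrite hornerZ hornerMn hornerM hornerN hornerC horner_exp hornerD hornerN hornerX hornerC /=.
  rewrite mulN1r mulNrn mulrNN mulrC factS natrM invfM -mulr_natr.
  have f0 := fact_neq0 R k.
  by field; rewrite f0 nat1r pnatr_eq0.
have zero (D : set R) : measurable D -> (forall t, D t -> y <= t) ->
    \int[mu]_(t in D) tpow k y t = 0.
  move=> mD Dy; transitivity (\int[mu]_(t in D) (0 : R)).
    by apply: eq_Rintegral => t /set_mem /Dy yt; rewrite /tpow ltNge yt.
  by rewrite Rintegral_cst // mul0r.
have [by_|yb] := leP b y; first exact: case1.
have tyb : tpow k.+1 y b = 0 by rewrite /tpow ltNge (ltW yb).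
have [ya|ay] := leP y a.
  rewrite zero //; first by rewrite tyb /tpow ltNge ya subrr.
  by move=> t /=; rewrite in_itv /= => /andP[at_ _]; exact: le_trans at_.
have zyb : \int[mu]_(t in `]y, b]) tpow k y t = 0.
  by apply: zero => // t /=; rewrite in_itv /= => /andP[/ltW].
have := @Rintegral_itvB _ (tpow k y) (BLeft a) (BRight b) y (integrable_tpow k y a b).
rewrite !bnd_simp (ltW ay) (ltW yb) (case1 y (ltW ay) (lexx y)) zyb.
move=> /(_ isT isT)/eqP; rewrite subr_eq0 => /eqP ->.
by rewrite tyb /tpow ltxx.
Qed.

(** * Integrable and bounded measurable functions on the unit interval *)

Definition integrable01 (R : realType) (f : R -> R) : Prop :=
  mu.-integrable (I01 : set R) (EFin \o f).

(** The class of kernels and polynomials: closed under products, and harmless as a factor of an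
    integrable function. *)
Definition bmeasurable01 (R : realType) (f : R -> R) : Prop :=
  measurable_fun (I01 : set R) f /\
  exists M, forall x, 0 <= x <= 1 -> `|f x| <= M.

Lemma measurable01 (R : realType) : measurable (I01 : set R).
Proof. exact: measurable_itv. Qed.

Lemma bounded01 (R : realType) (f : R -> R) : bmeasurable01 f ->
  [bounded f x | x in (I01 : set R)].
Proof.
move=> [_ [M hM]]; exists M; split; first exact: num_real.
move=> x Mx z; rewrite /= in_itv /= => hz.
exact: le_trans (hM _ hz) (ltW Mx).
Qed.

Lemma bmeasurable01_integrable (R : realType) (f : R -> R) :
  bmeasurable01 f -> integrable01 f.
Proof.
move=> hf; apply: measurable_bounded_integrable => //.
- by rewrite /= lebesgue_measure_itv /= lte_fin ltr01 -EFinB ltry.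
- by case: hf.
- exact: bounded01.
Qed.

Lemma integrable01D (R : realType) (f g : R -> R) :
  integrable01 f -> integrable01 g -> integrable01 (fun x => f x + g x).
Proof.
move=> hf hg; rewrite /integrable01.
have -> : EFin \o (fun x => f x + g x) = ((EFin \o f) \+ (EFin \o g))%E by [].
exact: integrableD.
Qed.

Lemma integrable01Z (R : realType) (a : R) (f : R -> R) :
  integrable01 f -> integrable01 (fun x => a * f x).
Proof.
move=> hf; rewrite /integrable01.
have -> : EFin \o (fun x => a * f x) = (fun x => a%:E * (EFin \o f) x)%E by [].
exact: integrableZl.
Qed.

Lemma integrable01M (R : realType) (f g : R -> R) :
  bmeasurable01 f -> integrable01 g -> integrable01 (fun x => f x * g x).
Proof.
move=> hf hg; have [mf _] := hf.
rewrite /integrable01.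
have -> : EFin \o (fun x => f x * g x) = ((EFin \o f) \* (EFin \o g))%E by [].
apply: integrableMr => //; exact: bounded01.
Qed.

Lemma bmeasurable01_cst (R : realType) (c : R) : bmeasurable01 (fun=> c).
Proof. by split; [exact: measurable_cst|exists `|c|]. Qed.

Lemma bmeasurable01D (R : realType) (f g : R -> R) :
  bmeasurable01 f -> bmeasurable01 g -> bmeasurable01 (fun x => f x + g x).
Proof.
move=> [mf [M hM]] [mg [M' hM']]; split; first exact: measurable_funD.
exists (M + M') => x hx; rewrite (le_trans (ler_normD _ _)) // lerD ?hM ?hM' //.
Qed.

Lemma bmeasurable01M (R : realType) (f g : R -> R) :
  bmeasurable01 f -> bmeasurable01 g -> bmeasurable01 (fun x => f x * g x).
Proof.
move=> [mf [M hM]] [mg [M' hM']]; split; first exact: measurable_funM.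
by exists (M * M') => x hx; rewrite normrM ler_pM ?hM ?hM'.
Qed.

Lemma bmeasurable01Z (R : realType) (a : R) (f : R -> R) :
  bmeasurable01 f -> bmeasurable01 (fun x => a * f x).
Proof. by move=> hf; apply: bmeasurable01M => //; exact: bmeasurable01_cst. Qed.

Lemma bmeasurable01_sum (R : realType) (I : Type) (s : seq I) (F : I -> R -> R) :
  (forall i, bmeasurable01 (F i)) -> bmeasurable01 (fun x => \sum_(i <- s) F i x).
Proof.
move=> hF; elim: s => [|i s IH].
  by under eq_fun do rewrite big_nil; exact: bmeasurable01_cst.
by under eq_fun do rewrite big_cons; exact: bmeasurable01D.
Qed.

Lemma bmeasurable01_tpow (R : realType) (k : nat) (y : R) : bmeasurable01 (tpow k y).
Proof.
split; first exact: measurable_tpow.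
by exists (`|y - 0| ^+ k / k`!%:R) => x /andP[x0 _]; exact: tpow_le.
Qed.

Lemma bmeasurable01_horner (R : realType) (p : {poly R}) : bmeasurable01 (horner p).
Proof.
split.
  by apply: measurable_funTS; apply: continuous_measurable_fun; exact: continuous_horner.
exists (\sum_(i < size p) `|p`_i|) => x /andP[x0 x1].
rewrite horner_coef (le_trans (ler_norm_sum _ _ _)) // ler_sum // => i _.
by rewrite normrM normrX (ger0_norm x0) ler_piMr // exprn_ile1.
Qed.

Lemma Rintegral01D (R : realType) (f g : R -> R) :
  integrable01 f -> integrable01 g ->
  \int[mu]_(x in I01) (f x + g x) = \int[mu]_(x in I01) f x + \int[mu]_(x in I01) g x.
Proof. by move=> hf hg; apply: RintegralD => //; exact: measurable01. Qed.

Lemma Rintegral01Z (R : realType) (a : R) (f : R -> R) : integrable01 f ->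
  \int[mu]_(x in I01) (a * f x) = a * \int[mu]_(x in I01) f x.
Proof. by move=> hf; apply: RintegralZl => //; exact: measurable01. Qed.

Lemma integrable01_sum (R : realType) (I : Type) (s : seq I) (F : I -> R -> R) :
  (forall i, integrable01 (F i)) ->
  integrable01 (fun x => \sum_(i <- s) F i x) /\
  \int[mu]_(x in I01) (\sum_(i <- s) F i x) = \sum_(i <- s) \int[mu]_(x in I01) F i x.
Proof.
move=> hF; elim: s => [|i s [IH1 IH2]].
  under eq_fun do rewrite big_nil.
  split; first exact/bmeasurable01_integrable/bmeasurable01_cst.
  by rewrite big_nil Rintegral_cst ?mul0r.
split; first by under eq_fun do rewrite big_cons; exact: integrable01D.
rewrite big_cons -IH2 -Rintegral01D //.
by apply: eq_Rintegral => x _; rewrite big_cons.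
Qed.

Lemma tpow_at0 (R : realType) (k : nat) (y : R) : 0 <= y ->
  tpow k.+1 y 0 = y ^+ k.+1 / k.+1`!%:R.
Proof.
rewrite /tpow subr0 le_eqVlt => /predU1P[<-|-> //].
by rewrite ltxx expr0n /= mul0r.
Qed.

Lemma tpow_at1 (R : realType) (k : nat) (y : R) : y <= 1 -> tpow k y 1 = 0.
Proof. by move=> y1; rewrite /tpow ltNge y1. Qed.

(** Integration by parts for absolutely continuous u without differentiating it: u is written as
    u(0) plus the integral of v, and exchanging the integrals integrates the truncated power
    instead. *)
Lemma tpow_by_parts (R : realType) (k : nat) (y : R) (u v : R -> R) :
  0 <= y <= 1 -> indefinite_integral u v ->
  \int[mu]_(s in I01) (tpow k y s * u s)
  = u 0 * (y ^+ k.+1 / k.+1`!%:R) + \int[mu]_(t in I01) (tpow k.+1 y t * v t).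
Proof.
move=> /andP[y0 y1] [iv hu].
pose U (s : R) := \int[mu]_(t in `[0, s]) v t.
have bt := @bmeasurable01_tpow R k y.
have iU : integrable01 U.
  apply: continuous_compact_integrable; first exact: segment_compact.
  exact: parameterized_integral_continuous.
transitivity (\int[mu]_(s in I01) (u 0 * tpow k y s + tpow k y s * U s)).
  apply: eq_Rintegral => s; rewrite mem_setE in_itv /= => hs.
  by rewrite hu // mulrDr mulrC.
rewrite Rintegral01D; last 2 first.
- exact/integrable01Z/bmeasurable01_integrable.
- exact: integrable01M.
rewrite Rintegral01Z; last exact: bmeasurable01_integrable.
rewrite Rintegral_tpow ?ler01 // tpow_at0 // tpow_at1 // subr0; congr (_ + _).
have [mt [M hM]] := bt.
rewrite (Rintegral_swap_triangle mt hM iv); apply: eq_Rintegral => t.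
rewrite mem_setE in_itv /= => /andP[_ t1].
by rewrite Rintegral_tpow // tpow_at1 // subr0 mulrC.
Qed.

Lemma tpow_iter_by_parts (R : realType) (m i l : nat) (y : R) (D : nat -> R -> R) :
  0 <= y <= 1 -> (forall k, (k < m)%N -> indefinite_integral (D k) (D k.+1)) ->
  (i + l <= m)%N ->
  \int[mu]_(s in I01) (tpow 0 y s * D i s)
  = \sum_(j < l) D (i + j)%N 0 * (y ^+ j.+1 / j.+1`!%:R)
    + \int[mu]_(t in I01) (tpow l y t * D (i + l)%N t).
Proof.
move=> hy hD; elim: l => [|l IH] hl; first by rewrite big_ord0 add0r addn0.
rewrite IH; last by apply: leq_trans hl; rewrite leq_add2l.
rewrite big_ord_recr /= -addrA addnS; congr (_ + _).
by apply: tpow_by_parts => //; apply: hD; rewrite -addnS.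
Qed.

(** Taylor's formula with integral remainder. The increment from 0 to y is the integral of D 1
    against [tpow 0 y], the indicator of t < y, and m - 1 integrations by parts follow. *)
Lemma taylor_point (R : realType) (m : nat) (y : R) (D : nat -> R -> R) :
  (0 < m)%N -> 0 <= y <= 1 ->
  (forall k, (k < m)%N -> indefinite_integral (D k) (D k.+1)) ->
  D 0%N y = \sum_(j < m) D j 0 * (y ^+ j / j`!%:R)
            + \int[mu]_(t in I01) (tpow m.-1 y t * D m t).
Proof.
case: m => // m _ hy hD.
rewrite big_ord_recl expr0 fact0 divr1 mulr1 -addrA.
have := @tpow_iter_by_parts _ m.+1 1 m y D hy hD; rewrite add1n => /(_ (leqnn _)) /= e.
rewrite (eq_bigr (fun j : 'I_m => D (1 + j)%N 0 * (y ^+ j.+1 / j.+1`!%:R))) //.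
rewrite -e; have [i1 ->] := hD 0%N isT; last exact: hy.
congr (_ + _); case/andP: hy => y0 y1.
have sub : `[0, y[ `<=` (I01 : set R).
  move=> x /=; rewrite !in_itv /= => /andP[-> xy] /=.
  exact: le_trans (ltW xy) y1.
rewrite -Rintegral_itv_bndo_bndc; last by apply: integrableS i1.
rewrite -(setIidr sub) Rintegral_mkcondr; apply: eq_Rintegral => t.
rewrite mem_setE in_itv /= patchE mem_setE in_itv /= => /andP[-> _] /=.
by rewrite /tpow; case: ifP => _; rewrite ?expr0 ?fact0 ?divr1 ?mul1r ?mul0r.
Qed.

Lemma indefinite_integral_integrable (R : realType) (u v : R -> R) :
  indefinite_integral u v -> integrable01 u.
Proof.
move=> [iv hu].
have iU : integrable01 (fun s => \int[mu]_(t in `[0, s]) v t).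
  apply: continuous_compact_integrable; first exact: segment_compact.
  exact: parameterized_integral_continuous.
have : integrable01 (fun s => u 0 + \int[mu]_(t in `[0, s]) v t).
  apply: integrable01D => //; exact/bmeasurable01_integrable/bmeasurable01_cst.
apply: eq_integrable; first exact: measurable01.
by move=> s; rewrite mem_setE in_itv /= => hs; rewrite /= (hu s hs).
Qed.

Lemma indefinite_integral_lincomb (R : realType) (a : R) (u1 v1 u2 v2 : R -> R) :
  indefinite_integral u1 v1 -> indefinite_integral u2 v2 ->
  indefinite_integral (fun x => u1 x + a * u2 x) (fun x => v1 x + a * v2 x).
Proof.
move=> [i1 h1] [i2 h2]; split.
  by apply: integrable01D => //; exact: integrable01Z.
move=> x hx; rewrite (h1 x hx) (h2 x hx); case/andP: hx => x0 x1.
have sub : `[0, x] `<=` (I01 : set R) by apply: subset_itvl; rewrite bnd_simp.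
have i1x : mu.-integrable (`[0, x] : set R) (EFin \o v1) by exact: integrableS i1.
have i2x : mu.-integrable (`[0, x] : set R) (EFin \o v2) by exact: integrableS i2.
have i3x : mu.-integrable (`[0, x] : set R) (EFin \o (fun t => a * v2 t)).
  by apply: integrableS (integrable01Z a i2).
rewrite RintegralD //.
by rewrite RintegralZl //; ring.
Qed.

Lemma indefinite_integral_tpow (R : realType) (k : nat) (y : R) :
  indefinite_integral (tpow k.+1 y) (fun x => - tpow k y x).
Proof.
have bt : bmeasurable01 (fun x => -1 * tpow k y x).
  exact/bmeasurable01Z/bmeasurable01_tpow.
have e : (fun x => - tpow k y x) = (fun x => -1 * tpow k y x).
  by apply/funext => x; rewrite mulN1r.
rewrite e; split; first exact: bmeasurable01_integrable.
move=> x /andP[x0 x1]; rewrite RintegralZl //; last exact: integrable_tpow.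
by rewrite Rintegral_tpow //; ring.
Qed.

Lemma indefinite_integral_poly (R : realType) (p : {poly R}) :
  indefinite_integral (horner p) (horner p^`()).
Proof.
split; first exact/bmeasurable01_integrable/bmeasurable01_horner.
by move=> x /andP[x0 _]; rewrite Rintegral_deriv_poly // addrC subrK.
Qed.

(** * Test functions and the Peano representation of the error *)

Definition test_fun (R : realType) (m : nat) (phi g : R -> R) : Prop :=
  [/\ gen_derivative m phi g, bmeasurable01 phi & bmeasurable01 g].

Lemma test_fun_lincomb (R : realType) (m : nat) (a : R) (p1 g1 p2 g2 : R -> R) :
  test_fun m p1 g1 -> test_fun m p2 g2 ->
  test_fun m (fun x => p1 x + a * p2 x) (fun x => g1 x + a * g2 x).
Proof.
move=> [[D1 [e1 f1 h1]] b1 c1] [[D2 [e2 f2 h2]] b2 c2]; split.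
- exists (fun k x => D1 k x + a * D2 k x); rewrite e1 f1 e2 f2; split => // k hk.
  by apply: indefinite_integral_lincomb; [exact: h1|exact: h2].
- by apply: bmeasurable01D => //; exact: bmeasurable01Z.
- by apply: bmeasurable01D => //; exact: bmeasurable01Z.
Qed.

Lemma test_fun_poly (R : realType) (m : nat) (p : {poly R}) :
  test_fun m (horner p) (horner p^`(m)).
Proof.
split; try exact: bmeasurable01_horner.
exists (fun k => horner p^`(k)); split => // k _.
by rewrite derivnS; exact: indefinite_integral_poly.
Qed.

Lemma test_fun_tpow (R : realType) (m k : nat) (y : R) :
  test_fun m (tpow (m + k) y) (fun x => (-1) ^+ m * tpow k y x).
Proof.
split; [|exact: bmeasurable01_tpow|exact/bmeasurable01Z/bmeasurable01_tpow].
exists (fun j x => (-1) ^+ j * tpow (m + k - j) y x); split.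
- by apply/funext => x; rewrite expr0 mul1r subn0.
- by apply/funext => x; rewrite addKn.
move=> j hj; have -> : (m + k - j = (m + k - j.+1).+1)%N by lia.
(* Adding to the zero polynomial makes the linear combination a plain scalar multiple. *)
have := indefinite_integral_lincomb ((-1) ^+ j) (indefinite_integral_poly 0)
  (@indefinite_integral_tpow R (m + k - j.+1) y).
rewrite deriv0.
have -> : (fun x => horner 0 x + (-1) ^+ j * tpow (m + k - j.+1).+1 y x)
   = (fun x => (-1) ^+ j * tpow (m + k - j.+1).+1 y x).
  by apply/funext => x; rewrite horner0 add0r.
have -> : (fun x => horner 0 x + (-1) ^+ j * - tpow (m + k - j.+1) y x)
   = (fun x => (-1) ^+ j.+1 * tpow (m + k - j.+1) y x) => //.
by apply/funext => x; rewrite horner0 add0r exprS; ring.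
Qed.

Lemma test_fun_sum (R : realType) (m : nat) (I : Type) (s : seq I) (c : I -> R)
    (p g : I -> R -> R) : (forall i, test_fun m (p i) (g i)) ->
  test_fun m (fun x => \sum_(i <- s) c i * p i x) (fun x => \sum_(i <- s) c i * g i x).
Proof.
move=> h; elim: s => [|i s IH].
  have := test_fun_poly m (0 : {poly R}).
  rewrite derivnC; case: eqP => _;
  by congr (test_fun m _ _); apply/funext => x; rewrite horner0 big_nil.
have := test_fun_lincomb (c i) IH (h i).
by congr (test_fun m _ _); apply/funext => x; rewrite big_cons addrC.
Qed.

Lemma error_functional_lincomb (R : realType) (N : nat) (C : int -> R) (a : R)
    (p1 p2 : R -> R) : bmeasurable01 p1 -> bmeasurable01 p2 ->
  error_functional N C (fun x => p1 x + a * p2 x)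
  = error_functional N C p1 + a * error_functional N C p2.
Proof.
move=> b1 b2; rewrite /error_functional Rintegral01D; last 2 first.
- exact: bmeasurable01_integrable.
- exact/bmeasurable01_integrable/bmeasurable01Z.
rewrite Rintegral01Z; last exact: bmeasurable01_integrable.
rewrite (eq_bigr (fun b : 'I_N.+1 => C b%:Z * p1 (node R N b) + a * (C b%:Z * p2 (node R N b)))).
  by rewrite big_split /= -mulr_sumr; ring.
by move=> b _; ring.
Qed.

(** For 0 <= t <= 1 and m >= 1, this is the error of the rule at y -> [tpow m.-1 y t], whose
    integral over y in [0, 1] is [tpow m 1 t]. *)
Definition peano_kernel (R : realType) (m N : nat) (C : int -> R) (t : R) : R :=
  tpow m 1 t - \sum_(c < N.+1) C c%:Z * tpow m.-1 (node R N c) t.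

Lemma bmeasurable01_peano (R : realType) (m N : nat) (C : int -> R) :
  bmeasurable01 (peano_kernel m N C).
Proof.
rewrite /peano_kernel.
have -> : (fun t => tpow m 1 t - \sum_(c < N.+1) C c%:Z * tpow m.-1 (node R N c) t)
  = (fun t => tpow m 1 t + -1 * (\sum_(c < N.+1) C c%:Z * tpow m.-1 (node R N c) t)).
  by apply/funext => t; rewrite mulN1r.
apply: bmeasurable01D; first exact: bmeasurable01_tpow.
apply: bmeasurable01Z; apply: bmeasurable01_sum => c.
exact/bmeasurable01Z/bmeasurable01_tpow.
Qed.

Lemma node01 (R : realType) (N : nat) (c : 'I_N.+1) : 0 <= node R N c <= 1.
Proof.
rewrite /node mulr_ge0 ?invr_ge0 //=.
have [e|N0] := posnP N.
  by have -> : N%:R = 0 :> R by [rewrite e]; rewrite invr0 mul0r ler01.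
by rewrite mulrC ler_pdivrMr ?ltr0n // mul1r ler_nat -ltnS.
Qed.

(** Taylor's formula at each node splits the error into a polynomial part, removed by exactness, and
    remainders that add up to the kernel. *)
Lemma peano_representation (R : realType) (m N : nat) (C : int -> R) (phi g : R -> R) :
  (0 < m)%N ->
  (forall a, (a < m)%N -> \sum_(c < N.+1) C c%:Z * node R N c ^+ a = a.+1%:R^-1) ->
  gen_derivative m phi g ->
  error_functional N C phi = \int[mu]_(t in I01) (peano_kernel m N C t * g t).
Proof.
move=> m0 hC [D [e0 em hD]].
have ig : integrable01 g.
  by have [] := hD m.-1; rewrite ?prednK // em.
have h1 : 0 <= (1 : R) <= 1 by rewrite ler01 lexx.
have i0 : integrable01 phi.
  by rewrite -e0; exact: indefinite_integral_integrable (hD 0%N m0).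
have it k y : integrable01 (fun t => tpow k y t * g t).
  by apply: integrable01M => //; exact: bmeasurable01_tpow.
(* The integral of phi is its pairing with [tpow 0 1], which equals 1 on [0, 1); m integrations by
   parts expand it. *)
have I0 : \int[mu]_(x in I01) phi x
    = \sum_(j < m) D j 0 * (j.+1`!%:R)^-1 + \int[mu]_(t in I01) (tpow m 1 t * g t).
  have := @tpow_iter_by_parts _ m 0 m 1 D h1 hD; rewrite !add0n em => /(_ (leqnn _)).
  rewrite (eq_bigr (fun j : 'I_m => D j 0 * (j.+1`!%:R)^-1)); last first.
    by move=> j _; rewrite expr1n div1r add0n.
  move=> <-; rewrite e0.
  have sub : `[0, 1[ `<=` (I01 : set R) by apply: subset_itvl; rewrite bnd_simp.
  rewrite -Rintegral_itv_bndo_bndc; last by apply: integrableS i0.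
  rewrite -Rintegral_itv_bndo_bndc; last first.
    have i0' : integrable01 (fun t => tpow 0 1 t * phi t).
      by apply: integrable01M => //; exact: bmeasurable01_tpow.
    by apply: integrableS i0'.
  apply: eq_Rintegral => t; rewrite mem_setE in_itv /= => /andP[_ t1].
  by rewrite /tpow t1 expr0 fact0 divr1 mul1r.
have K0 : \int[mu]_(t in I01) (peano_kernel m N C t * g t)
    = \int[mu]_(t in I01) (tpow m 1 t * g t)
      - \sum_(c < N.+1) C c%:Z * \int[mu]_(t in I01) (tpow m.-1 (node R N c) t * g t).
  have iF (c : 'I_N.+1) : integrable01 (fun t => C c%:Z * (tpow m.-1 (node R N c) t * g t)).
    exact: integrable01Z.
  have [iS eS] := integrable01_sum (index_enum _) iF.
  rewrite (eq_bigr (fun c : 'I_N.+1 =>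
     \int[mu]_(t in I01) (C c%:Z * (tpow m.-1 (node R N c) t * g t)))); last first.
    by move=> c _; rewrite Rintegral01Z.
  rewrite -eS -mulN1r -Rintegral01Z // -Rintegral01D //; last exact: integrable01Z.
  apply: eq_Rintegral => t _; rewrite /peano_kernel mulrBl mulN1r; congr (_ - _).
  by rewrite mulr_suml; apply: eq_bigr => c _; rewrite mulrA.
rewrite /error_functional K0 I0 -e0.
rewrite (eq_bigr (fun c : 'I_N.+1 => \sum_(j < m) C c%:Z * (D j 0 * (node R N c ^+ j / j`!%:R))
    + C c%:Z * \int[mu]_(t in I01) (tpow m.-1 (node R N c) t * g t))); last first.
  by move=> c _; rewrite (taylor_point m0 (node01 R c) hD) em mulrDr mulr_sumr.
rewrite big_split /= exchange_big /=.
have -> : \sum_(j < m) \sum_(c < N.+1) C c%:Z * (D j 0 * (node R N c ^+ j / j`!%:R))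
    = \sum_(j < m) D j 0 * (j.+1`!%:R)^-1; last by ring.
apply: eq_bigr => j _; have e := hC j (ltn_ord j).
transitivity (D j 0 / j`!%:R * \sum_(c < N.+1) C c%:Z * node R N c ^+ j).
  by rewrite mulr_sumr; apply: eq_bigr => c _; ring.
by rewrite e factS natrM invfM; ring.
Qed.

(** * Optimality *)

Lemma Rintegral_sq_lincomb (R : realType) (f g : R -> R) (a b : R) :
  integrable01 (fun x => f x ^+ 2) -> integrable01 (fun x => f x * g x) ->
  integrable01 (fun x => g x ^+ 2) ->
  \int[mu]_(x in I01) (a * f x + b * g x) ^+ 2
  = a ^+ 2 * \int[mu]_(x in I01) f x ^+ 2
    + 2 * (a * b) * \int[mu]_(x in I01) (f x * g x)
    + b ^+ 2 * \int[mu]_(x in I01) g x ^+ 2.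
Proof.
move=> i1 i2 i3.
rewrite -!Rintegral01Z // -!Rintegral01D //; try exact: integrable01Z; last first.
  by apply: integrable01D; exact: integrable01Z.
by apply: eq_Rintegral => x _; ring.
Qed.

Lemma discriminant_le0 (R : realType) (A B G : R) :
  (forall a b, 0 <= a ^+ 2 * A + 2 * (a * b) * B + b ^+ 2 * G) -> B ^+ 2 <= A * G.
Proof.
move=> h; have G0 : 0 <= G by have := h 0 1; lra.
have [G1|Gn] := eqVneq G 0; last first.
  have Gp : 0 < G by rewrite lt_def Gn.
  (* The form is minimal in a direction proportional to (G, - B). *)
  have h1 := h G (- B); have : 0 <= G * (A * G - B ^+ 2) by nra.
  by rewrite pmulr_rge0 // subr_ge0.
rewrite G1 mulr0; have [->|Bn] := eqVneq B 0; first by rewrite expr0n.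
(* With G = 0 and a = 1 the form is affine in b, and this b gives it the value - 1. *)
have := h 1 (- (A + 1) / (2 * B)); rewrite G1.
have -> : 1 ^+ 2 * A + 2 * (1 * (- (A + 1) / (2 * B))) * B + (- (A + 1) / (2 * B)) ^+ 2 * 0
  = -1 by field.
by rewrite lerNr oppr0 ler10.
Qed.

Lemma integrable01_sqr (R : realType) (f : R -> R) :
  bmeasurable01 f -> integrable01 (fun x => f x ^+ 2).
Proof.
move=> bf; have -> : (fun x => f x ^+ 2) = (fun x => f x * f x) by apply/funext => x.
by apply: integrable01M => //; exact: bmeasurable01_integrable.
Qed.

Lemma Rintegral_cauchy_schwarz (R : realType) (f g : R -> R) :
  bmeasurable01 f -> integrable01 g -> integrable01 (fun x => g x ^+ 2) ->
  (\int[mu]_(x in I01) (f x * g x)) ^+ 2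
  <= (\int[mu]_(x in I01) f x ^+ 2) * \int[mu]_(x in I01) g x ^+ 2.
Proof.
move=> bf ig ig2; apply: discriminant_le0 => a b.
rewrite -Rintegral_sq_lincomb //.
- by apply: Rintegral_ge0 => x _; exact: sqr_ge0.
- exact: integrable01_sqr.
- exact: integrable01M.
Qed.

Lemma Rintegral_sqr_ge0 (R : realType) (f : R -> R) : 0 <= \int[mu]_(x in I01) f x ^+ 2.
Proof. by apply: Rintegral_ge0 => x _; exact: sqr_ge0. Qed.

Lemma error_norm_le_peano (R : realType) (m N : nat) (C : int -> R) :
  (0 < m)%N ->
  (forall a, (a < m)%N -> \sum_(c < N.+1) C c%:Z * node R N c ^+ a = a.+1%:R^-1) ->
  (error_norm m N C <= (L2norm (peano_kernel m N C))%:E)%E.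
Proof.
move=> m0 hC; apply: ge_ereal_sup => z [phi [r [[g [gd [mg ig2] ->]] r0 ->]]].
have ig : integrable01 g.
  by have [D [_ <- hD]] := gd; have [] := hD m.-1; rewrite ?prednK // ltn_predL.
have rp : 0 < L2norm g by rewrite lt_def r0 sqrtr_ge0.
rewrite lee_fin ler_pdivrMr // (peano_representation m0 hC gd).
rewrite -sqrtrM ?Rintegral_sqr_ge0 // -sqrtr_sqr ler_sqrt; last first.
  by rewrite mulr_ge0 ?Rintegral_sqr_ge0.
by apply: Rintegral_cauchy_schwarz => //; exact: bmeasurable01_peano.
Qed.

(** The supremum ranges over nonzero seminorms only. A phi of zero seminorm is perturbed by d x^m /
    m!, of seminorm |d|; small d then forces the error at phi to vanish. *)
Lemma error_norm_test_fun (R : realType) (m N : nat) (C : int -> R) (M : R)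
    (phi g : R -> R) :
  (error_norm m N C <= (Num.sqrt M)%:E)%E -> 0 <= M -> test_fun m phi g ->
  error_functional N C phi ^+ 2 <= M * \int[mu]_(x in I01) g x ^+ 2.
Proof.
move=> hM M0.
have pos p1 g1 : test_fun m p1 g1 -> \int[mu]_(x in I01) g1 x ^+ 2 != 0 ->
    error_functional N C p1 ^+ 2 <= M * \int[mu]_(x in I01) g1 x ^+ 2.
  move=> [gd b1 b2] n0.
  have r0 : L2norm g1 != 0.
    by rewrite sqrtr_eq0 -ltNge lt_def n0 Rintegral_sqr_ge0.
  have rp : 0 < L2norm g1 by rewrite lt_def r0 sqrtr_ge0.
  have : ((`|error_functional N C p1| / L2norm g1)%:E <= (Num.sqrt M)%:E)%E.
    apply: le_trans hM; apply: ereal_sup_ubound; exists p1, (L2norm g1); split => //.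
    exists g1; split => //; split; first by case: b2.
    exact: integrable01_sqr.
  rewrite lee_fin ler_pdivrMr // -sqrtrM // -sqrtr_sqr ler_sqrt //.
  by rewrite mulr_ge0 // Rintegral_sqr_ge0.
move=> tf; have [g0|] := eqVneq (\int[mu]_(x in I01) g x ^+ 2) 0; last exact: pos.
rewrite g0 mulr0.
pose chi : {poly R} := (m`!%:R^-1) *: 'X^m.
have chim : horner chi^`(m) = (fun=> 1).
  apply/funext => x; rewrite /chi derivnZ derivnXn ffactnn subnn expr0.
  by rewrite hornerZ hornerMn hornerC mulVf // fact_neq0.
have tchi : test_fun m (horner chi) (fun=> 1) by rewrite -chim; exact: test_fun_poly.
have [gd bphi bg] := tf; have [_ bchi b1] := tchi.
set e := error_functional N C phi.
set c := error_functional N C (horner chi).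
have one : \int[mu]_(x in I01) (1 : R) ^+ 2 = 1.
  rewrite Rintegral_cst //= lebesgue_measure_itv /= lte_fin ltr01 /=.
  by rewrite subr0 mulr1 expr1n.
have ig1 : \int[mu]_(x in I01) (g x * 1) = 0.
  apply/eqP; rewrite -sqrf_eq0 eq_le sqr_ge0 andbT.
  have := Rintegral_cauchy_schwarz bg (bmeasurable01_integrable b1) (integrable01_sqr b1).
  by rewrite g0 mul0r.
have key d : d != 0 -> (e + d * c) ^+ 2 <= M * d ^+ 2.
  move=> d0; have t1 := test_fun_lincomb d tf tchi.
  have i1 : \int[mu]_(x in I01) (g x + d * 1) ^+ 2 = d ^+ 2.
    transitivity (\int[mu]_(x in I01) (1 * g x + d * 1) ^+ 2).
      by apply: eq_Rintegral => x _; rewrite mul1r.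
    rewrite (Rintegral_sq_lincomb 1 d (integrable01_sqr bg)
      (integrable01M bg (bmeasurable01_integrable b1)) (integrable01_sqr b1)).
    by rewrite g0 ig1 one; ring.
  have := pos _ _ t1; rewrite i1 error_functional_lincomb //; apply.
  by rewrite expf_neq0.
rewrite (_ : e = 0) ?expr0n //; apply/eqP; apply: contraT => e0.
(* Small enough that 1 + t c >= 1/2 while M t^2 < 1/4, which contradicts [key] at d = e t. *)
pose t : R := (2 * (`|c| + M + 1))^-1.
have ca := normr_ge0 c.
have tp : 0 < t by rewrite invr_gt0; lra.
have te : t * (2 * (`|c| + M + 1)) = 1 by rewrite mulVf // gt_eqF //; lra.
have et0 : e * t != 0 by rewrite mulf_neq0 // gt_eqF.
have := key (e * t) et0.
have -> : (e + e * t * c) ^+ 2 = e ^+ 2 * (1 + t * c) ^+ 2 by ring.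
have e2 : 0 < e ^+ 2 by rewrite lt_def sqrf_eq0 e0 sqr_ge0.
have -> : M * (e * t) ^+ 2 = e ^+ 2 * (M * t ^+ 2) by ring.
rewrite ler_pM2l //.
have h1 : 2^-1 <= 1 + t * c.
  have := ler_norm (- c); rewrite normrN => nc; nra.
have h2 : M * t ^+ 2 < 4^-1.
  have h3 : t * M < 2^-1 by nra.
  have h4 : t <= 2^-1 by nra.
  nra.
nra.
Qed.

(** The first variation at a maximum: a small e of the sign of X, here X / (|Y| + 1), would make the
    linear term dominate. *)
Lemma linear_coef_eq0 (R : realType) (X Y : R) :
  (forall e, 2 * (e * X) + e ^+ 2 * Y <= 0) -> X = 0.
Proof.
move=> h; apply/eqP; apply: contraT => X0.
have X2 : 0 < X ^+ 2 by rewrite lt_def sqrf_eq0 X0 sqr_ge0.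
have ay := normr_ge0 Y.
pose t : R := (`|Y| + 1)^-1.
have tp : 0 < t by rewrite invr_gt0; lra.
have te : t * (`|Y| + 1) = 1 by rewrite mulVf // gt_eqF //; lra.
have hY : - `|Y| <= Y by have := ler_norm (- Y); rewrite normrN; lra.
have := h (X * t).
have -> : 2 * (X * t * X) + (X * t) ^+ 2 * Y = (t * X ^+ 2) * (2 + t * Y) by ring.
have tX : 0 < t * X ^+ 2 by exact: mulr_gt0.
rewrite pmulr_rle0 // => h1; nra.
Qed.

Lemma node_inj (R : realType) (N : nat) : (0 < N)%N ->
  injective (fun c : 'I_N.+1 => node R N c).
Proof.
move=> N0 b c /eqP; have N0' : N%:R^-1 != 0 :> R by rewrite invr_eq0 pnatr_eq0 -lt0n.
by rewrite /node (inj_eq (mulfI N0')) eqr_nat => /eqP/val_inj.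
Qed.

Lemma sard_optimal_solution (R : realType) (m N : nat) (C : int -> R)
    (Cs : 'rV[R]_N.+1) (lam : 'rV[R]_m) :
  (0 < m)%N -> (0 < N)%N -> sobolev_system Cs lam -> sard_optimal m N C ->
  forall c : 'I_N.+1, C c%:Z = Cs 0 c.
Proof.
move=> m0 N0 hs [_ hopt].
have [P hP eP] := sobolev_system_truncated m0 N0 hs.
pose C' (b : int) : R := Cs 0 (inord `|b|%N).
have C'E (c : 'I_N.+1) : C' c%:Z = Cs 0 c by rewrite /C' /= inord_val.
have exC' a : (a < m)%N ->
    \sum_(c < N.+1) C' c%:Z * node R N c ^+ a = a.+1%:R^-1.
  move=> ha; rewrite -(hs.2 (Ordinal ha)).
  by apply: eq_bigr => c _; rewrite C'E.
set K := peano_kernel m N C'; set M2 := \int[mu]_(x in I01) K x ^+ 2.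
have bK : bmeasurable01 K by exact: bmeasurable01_peano.
have M20 : 0 <= M2 by exact: Rintegral_sqr_ge0.
have hM : (error_norm m N C <= (Num.sqrt M2)%:E)%E.
  exact: le_trans (hopt C') (error_norm_le_peano m0 exC').
pose sg : R := (-1) ^+ m.
have sg2 : sg ^+ 2 = 1 by rewrite /sg sqrr_sign.
(* The kernel K integrated m times, up to the sign (-1)^m from differentiating in t. P is the
   polynomial of [sobolev_system_truncated], whose subtraction makes psi vanish at the nodes. *)
pose psi x := (tpow (m + m) 1 x
  + -1 * \sum_(c < N.+1) C' c%:Z * tpow (m + m.-1) (node R N c) x) + -1 * P.[x].
have tpsi : test_fun m psi (fun x => sg * K x).
  have t1 := test_fun_tpow m m (1 : R).
  have t2 := @test_fun_sum R m _ (index_enum 'I_N.+1) (fun c => C' c%:Z) _ _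
    (fun c => test_fun_tpow m m.-1 (node R N c)).
  have := test_fun_lincomb (-1) (test_fun_lincomb (-1) t1 t2) (test_fun_poly m P).
  congr (test_fun m _ _); apply/funext => x.
  have -> : P^`(m) = 0.
    apply/polyP => i; rewrite coef_derivn nth_default ?mul0rn ?coef0 //.
    by rewrite (leq_trans hP) // leq_addr.
  rewrite horner0 mulr0 addr0 /K /peano_kernel mulrBr mulN1r mulr_sumr; congr (_ - _).
  by apply: eq_bigr => c _; rewrite mulrCA.
have psi0 (b : 'I_N.+1) : psi (node R N b) = 0.
  have Np : 0 < N%:R^-1 :> R by rewrite invr_gt0 ltr0n.
  rewrite /psi (eq_bigr (fun c : 'I_N.+1 => Cs 0 c * (if (b < c)%N
      then (node R N c - node R N b) ^+ (2 * m - 1) / (2 * m - 1)`!%:R else 0))).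
    rewrite eP; last by rewrite -ltnS.
    have -> : tpow (m + m) 1 (node R N b) = (1 - node R N b) ^+ (2 * m) / (2 * m)`!%:R.
      rewrite addnn -mul2n /tpow; case: ltP => // h.
      have /andP[_ h'] := node01 R b; have -> : node R N b = 1 by apply/le_anti/andP.
      by rewrite subrr expr0n muln_eq0 /= gtn_eqF // mul0r.
    by ring.
  move=> c _; rewrite C'E /tpow /node ltr_pM2l // ltr_nat.
  by rewrite (_ : m + m.-1 = 2 * m - 1)%N //; lia.
(* No rule sees psi at its nodes, so all rules have the same error there, computed for C' by its
   Peano kernel. *)
have errpsi (A : int -> R) : error_functional N A psi = sg * M2.
  have e (B : int -> R) : error_functional N B psi = \int[mu]_(x in I01) psi x.
    by rewrite /error_functional big1 ?subr0 // => c _; rewrite psi0 mulr0.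
  rewrite e -(e C'); have [gd _ _] := tpsi.
  rewrite (peano_representation m0 exC' gd) -/K /M2 -Rintegral01Z; last exact: integrable01_sqr.
  by apply: eq_Rintegral => x _; ring.
(* The norm bound is tested at psi + e p. It is an equality at e = 0, so its linear term in e
   vanishes, which equates the two errors at p. *)
have key (p : {poly R}) : error_functional N C (horner p) = error_functional N C' (horner p).
  have tp := test_fun_poly m p; have [gd bp bg] := tp.
  set g := horner p^`(m) in tp gd bg.
  set a := error_functional N C _; set b := error_functional N C' _.
  have eb : b = \int[mu]_(t in I01) (K t * g t) by exact: peano_representation.
  pose G := \int[mu]_(t in I01) g t ^+ 2.
  have iKg : integrable01 (fun x => K x * g x).
    exact: (integrable01M bK (bmeasurable01_integrable bg)).
  have bG : b ^+ 2 <= M2 * G.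
    rewrite eb; apply: Rintegral_cauchy_schwarz => //.
      exact: bmeasurable01_integrable.
    exact: integrable01_sqr.
  have var e : (sg * M2 + e * a) ^+ 2 <= M2 * (M2 + 2 * (sg * e) * b + e ^+ 2 * G).
    have tf := test_fun_lincomb e tpsi tp.
    have := error_norm_test_fun hM M20 tf.
    rewrite error_functional_lincomb ?errpsi //; last by case: tpsi.
    rewrite (Rintegral_sq_lincomb sg e (integrable01_sqr bK) iKg (integrable01_sqr bg)).
    by rewrite sg2 mul1r -eb.
  (* If K has zero norm, the bound and Cauchy-Schwarz make both errors vanish; otherwise M2 can be
     cancelled. *)
  have [M2e|M2n] := eqVneq M2 0.
    have a0 : a = 0.
      apply/eqP; rewrite -sqrf_eq0 eq_le sqr_ge0 andbT.
      by have := var 1; rewrite M2e mulr0 add0r mul1r mul0r.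
    rewrite a0; apply/esym/eqP; rewrite -sqrf_eq0 eq_le sqr_ge0 andbT.
    by rewrite M2e mul0r in bG.
  have : sg * M2 * (a - b) = 0.
    apply: (@linear_coef_eq0 _ _ (a ^+ 2 - M2 * G)) => e.
    have := var e; rewrite -subr_le0.
    have -> : (sg * M2 + e * a) ^+ 2 - M2 * (M2 + 2 * (sg * e) * b + e ^+ 2 * G)
      = 2 * (e * (sg * M2 * (a - b))) + e ^+ 2 * (a ^+ 2 - M2 * G)
        + (sg ^+ 2 - 1) * M2 ^+ 2 by ring.
    by rewrite sg2 subrr mul0r addr0.
  move=> /eqP; rewrite !mulf_eq0 (negPf M2n) orbF /sg signr_eq0 /= subr_eq0.
  by move=> /eqP.
(* A multiple of the Lagrange polynomial of node c isolates the coefficient there. *)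
move=> c; pose p := \prod_(j < N.+1 | j != c) ('X - (node R N j)%:P).
have pE (A : int -> R) : \sum_(b < N.+1) A b%:Z * p.[node R N b] = A c%:Z * p.[node R N c].
  rewrite (bigD1 c) //= big1 ?addr0 // => b bc.
  rewrite /p (bigD1 b) //= hornerM hornerXsubC subrr mul0r mulr0 //.
have pc : p.[node R N c] != 0.
  rewrite horner_prod; apply/prodf_neq0 => j jc.
  by rewrite hornerXsubC subr_eq0 (inj_eq (node_inj N0)) eq_sym.
have := key p; rewrite /error_functional => /addrI/oppr_inj; rewrite !pE => /(mulIf pc).
by rewrite C'E.
Qed.

Theorem theorem3 (R : realType) (m N : nat) (E : {poly R})
    (q : 'I_m.-1 -> R) (C : int -> R)
    (hm : (1 <= m)%N) (hN : (1 <= N)%N)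
    (hE : euler_frobenius (2 * m - 2) E)
    (hq : inner_roots E q)
    (hsys : sobolev_system_uniquely_solvable R m N)
    (hC0 : forall b : int, b < 0 \/ N%:Z < b -> C b = 0)
    (hC : sard_optimal m N C) :
  exists d : 'I_m.-1 -> R,
    (forall j : nat, (1 <= j <= m.-1)%N ->
       \sum_(k < m.-1) d k *
         (\sum_(1 <= i < j.+1)
            (q k + (-1) ^+ i.+1 * q k ^+ (N + i)) / (q k - 1) ^+ i.+1
            * diff0 R i j)
       = bernoulli R j.+1 / j.+1%:R) /\
    (forall b : int,
       C b = N%:R^-1 *
         (if (b == 0) || (b == N%:Z) then
            2^-1 - \sum_(k < m.-1) d k * ((q k - q k ^+ N) / (1 - q k))
          else if 0 < b < N%:Z then
            1 + \sum_(k < m.-1) d k * (q k ^ b + q k ^ (N%:Z - b))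
          else 0)).
Proof.
have [[Cs lam] [/= hs _]] := hsys.
have CE := sard_optimal_solution hm hN hs hC.
have [d [h1 h2 h3]] := sobolev_solution_form hm hN hE hq hsys hs.
exists d; split=> [//|b].
have [b0|b0] := ltP b 0.
  rewrite hC0; last by left.
  rewrite lt_eqF // ltNge (ltW b0) /= lt_eqF ?mulr0 //.
  by rewrite (lt_le_trans b0).
have [bN|bN] := ltP N%:Z b.
  rewrite hC0; last by right.
  by rewrite gt_eqF ?(le_lt_trans _ bN) // gt_eqF // (ltNge b) (ltW bN) andbF mulr0.
case: b b0 bN => [b|//] _; rewrite lez_nat => bN.
have bo : (b < N.+1)%N by [].
rewrite (CE (Ordinal bo)); rewrite !eqz_nat.
case: ifP => [hb|/negbT]; first by rewrite h2.
rewrite negb_or => /andP[b1 b2].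
have hb : (0 < b < N)%N by rewrite lt0n b1 ltn_neqAle b2.
rewrite !ltz_nat hb h3 //; congr (_ * (_ + _)).
by apply: eq_bigr => k _; rewrite subzn.
Qed.
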